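(* Consider a solution on $\mathcal{R}=T^*\mathrm{S}^2/\mathrm{O}(2)$ of the reduced 3-dimensional axisymmetric Veselova top, with mass tensor $\mathbb{J}=\mathrm{diag}[J_1,J_2,J_2]$. The possible reconstructions, to both $T^*\mathrm{S}^2$ and $D$, are as follows: - solutions in $S_3$ with $(q_1,p_1)\ne0$ reconstruct to quasi-periodic motion on 2-tori; - points $(0,0,P)\in S_3$ reconstruct to steady rotations in the equatorial plane; - solutions in $S_2$ with $P>0$ reconstruct to steady rotations in an axial plane; - all remaining points reconstruct to equilibria.
   Context: $\mathbb{J}=\mathrm{diag}[J_1,J_2,J_2]$ with $J_1,J_2>0$, $J_1\ne J_2$; $f_1,f_2,f_3$ is the standard (body) basis, $f_1$ the symmetry axis. On $\mathfrak{so}(3)$, $\mathbb{I}(\Omega)=\mathbb{J}\Omega+\Omega\mathbb{J}$, $\langle\Lambda,\Omega\rangle=\tfrac12\mathrm{tr}(\Lambda^T\Omega)$, $a\wedge b=ab^T-ba^T$. With $e_1,e_2,e_3$ the standard space basis, $q=g^{-1}e_1$, $E_r=g^{-1}e_r$, the phase space is $D=\{(g,\Omega)\in\mathrm{O}(3)\times\mathfrak{so}(3):\Omega=q\wedge v\text{ for some }v\}$ and the dynamics on $D$ is $\dot g=g\Omega$, $\frac{d}{dt}\mathbb{I}(\Omega)=[\mathbb{I}(\Omega),\Omega]+\lambda E_2\wedge E_3$, with $\lambda$ uniquely determined by preservation of the constraint $\langle E_2\wedge E_3,\Omega\rangle=0$. The map $(g,\Omega)\mapsto(q,p)=(g^{-1}e_1,-\mathbb{I}(\Omega)g^{-1}e_1)$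 projects $D$ to $T^*\mathrm{S}^2=\{(q,p):\|q\|=1,q\cdot p=0\}\subset\mathbb{R}^3\times\mathbb{R}^3$, with induced dynamics $$\dot q=C\left[p-\frac{p\cdot Cq}{q\cdot Cq}q\right],\quad \dot p=-2Hq,\quad C=(\mathbb{J}+(q\cdot\mathbb{J}q)\mathrm{Id}_3)^{-1},\quad H=\tfrac12\left(p\cdot Cp-\tfrac{(p\cdot Cq)^2}{q\cdot Cq}\right).$$ $\mathrm{O}(2)$ (orthogonal maps fixing $f_1$) acts diagonally. Write $q=(q_1,q_2)$, $p=(p_1,p_2)\in\mathbb{R}\times\mathbb{R}^2$ (from here on $q_2,p_2$ denote these $\mathbb{R}^2$-components), $P=\|p\|^2$. Points of $\mathcal{R}$ are described by $(q_1,p_1,P)$, and the dynamics on $\mathcal R$ is the one induced from $T^*\mathrm{S}^2$ (with $q_1,p_1$ evolving linearly and $P,H$ constant). Stratum $S_3$: images of points with $q_2,p_2$ linearly independent; stratum $S_2$: images of points with $q_2,p_2$ linearly dependent and not both zero. Reconstruction means the solutions on $T^*\mathrm{S}^2$ and on $D$ projecting to the given solution on $\mathcal{R}$. Quasi-periodic on 2-tori means contained in an invariant 2-dimensional torus on which the flow (in the time $t$) is conjugate to a linear flow. A steady rotation is a solution with $\Omega$ constant and nonzero, which is a multiple of $a\wedge b$ for a $\mathbb{J}$-invariant plane $\mathrm{span}\{a,b\}$; it is in an axial plane if that plane contains $f_1$, and in the equatorial plane if that plane is $f_1^\perp$. *)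

(* Defs.v *)
From HB Require Import structures.
From mathcomp Require Import all_boot all_order all_algebra.
From mathcomp Require Import all_classical all_reals all_analysis.
Set Implicit Arguments.
Unset Strict Implicit.
Unset Printing Implicit Defensive.
Import Order.TTheory GRing.Theory Num.Theory.
Import numFieldNormedType.Exports.
Local Open Scope classical_set_scope.
Local Open Scope ring_scope.

Section VeselovaTop.
Variable R : realType.

Notation vec := 'cV[R]_3.
Notation mat := 'M[R]_3.

(* The norm [`|_|] on matrices is the max norm; Euclidean lengths are
   expressed through [dot]. *)
Definition dot (u v : vec) : R := (u^T *m v) 0 0.

Definition wedge (a b : vec) : mat := a *m b^T - b *m a^T.

(* [basis 0], [basis 1], [basis 2] are the first, second and third vectors of
   the standard basis, used both for the space basis e and the body basis f. *)
Definition basis (i : 'I_3) : vec := delta_mx i 0.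

Definition mass (J1 J2 : R) : mat :=
  diag_mx (\row_(i < 3) (if i == 0 then J1 else J2)).

Definition inertia (J Om : mat) : mat := J *m Om + Om *m J.

Definition orthogonal : set mat := [set g | g^T *m g = 1%:M].

Definition skew : set mat := [set Om | Om^T = - Om].

Definition body (g : mat) (i : 'I_3) : vec := invmx g *m basis i.

Definition D : set (mat * mat) :=
  [set y | [/\ orthogonal y.1, skew y.2
             & exists v : vec, y.2 = wedge (body y.1 0) v]].

(* Since the curve is required to stay in [D], the multiplier [lam] is the one
   determined by preservation of the constraint. *)
Definition D_solution (J : mat) (y : R -> mat * mat) : Prop :=
  (forall t, D (y t)) /\
  exists lam : R -> R, forall t,
    let g := (y t).1 in let Om := (y t).2 in
    let M := inertia J Om in
    is_derive t 1 (fun s => (y s).1) (g *m Om) /\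
    is_derive t 1 (fun s => inertia J (y s).2)
      (M *m Om - Om *m M + lam t *: wedge (body g 1) (body g 2%:R)).

Definition TS : set (vec * vec) :=
  [set x | dot x.1 x.1 = 1 /\ dot x.1 x.2 = 0].

Definition proj (J : mat) (y : mat * mat) : vec * vec :=
  (body y.1 0, - (inertia J y.2 *m body y.1 0)).

Definition Cmx (J : mat) (q : vec) : mat :=
  invmx (J + (dot q (J *m q))%:M).

Definition qdot (J : mat) (q p : vec) : vec :=
  let C := Cmx J q in
  C *m (p - (dot p (C *m q) / dot q (C *m q)) *: q).

Definition Ham (J : mat) (q p : vec) : R :=
  let C := Cmx J q in
  2^-1 * (dot p (C *m p) - dot p (C *m q) ^+ 2 / dot q (C *m q)).

Definition TS_solution (J : mat) (x : R -> vec * vec) : Prop :=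
  forall t, [/\ TS (x t),
    is_derive t 1 (fun s => (x s).1) (qdot J (x t).1 (x t).2) &
    is_derive t 1 (fun s => (x s).2) (- (2 * Ham J (x t).1 (x t).2) *: (x t).1)].

Definition O2 : set mat :=
  [set h | orthogonal h /\ h *m basis 0 = basis 0].

(* Points of the quotient T*S^2/O(2) are represented as orbits. *)
Definition O2_orbit (x : vec * vec) : set (vec * vec) :=
  [set (h *m x.1, h *m x.2) | h in O2].

Definition coords (x : vec * vec) : R * R * R :=
  (x.1 0 0, x.2 0 0, dot x.2 x.2).

Definition has_coords (xi : set (vec * vec)) (c : R * R * R) : Prop :=
  exists x, [/\ TS x, xi = O2_orbit x & coords x = c].

Definition reduced_solution (J : mat) (gam : R -> set (vec * vec)) : Prop :=
  exists2 x, TS_solution J x & forall t, gam t = O2_orbit (x t).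

Definition planar (u : vec) : 'cV[R]_2 := row' 0 u.

Definition S3 : set (set (vec * vec)) :=
  [set O2_orbit x | x in [set x | TS x /\ free [:: planar x.1; planar x.2]]].

Definition S2 : set (set (vec * vec)) :=
  [set O2_orbit x | x in [set x | [/\ TS x, ~~ free [:: planar x.1; planar x.2]
                                 & (planar x.1, planar x.2) != (0, 0)]]].

Definition TS_reconstruction (J : mat) (gam : R -> set (vec * vec))
    (x : R -> vec * vec) : Prop :=
  TS_solution J x /\ forall t, O2_orbit (x t) = gam t.

Definition D_reconstruction (J : mat) (gam : R -> set (vec * vec))
    (y : R -> mat * mat) : Prop :=
  D_solution J y /\ forall t, O2_orbit (proj J (y t)) = gam t.

(* Through every point of the fibres over [gam 0] there is a reconstruction of
   [gam], on T*S^2 and on D. *)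
Definition reconstructible (J : mat) (gam : R -> set (vec * vec)) : Prop :=
  (forall x0, O2_orbit x0 = gam 0 ->
     exists2 x, TS_reconstruction J gam x & x 0 = x0) /\
  (forall y0, D y0 -> O2_orbit (proj J y0) = gam 0 ->
     exists2 y, D_reconstruction J gam y & y 0 = y0).

(* [phi] is a continuous map on R^2 which induces an injective map on the
   compact torus R^2/Z^2, so its range is an embedded 2-torus.  The third
   clause says that the solutions issuing from points of the torus are exactly
   the images of the linear flow with frequencies [w]. *)
Definition quasi_periodic (X : topologicalType) (sol : (R -> X) -> Prop)
    (x : R -> X) : Prop :=
  exists (phi : R * R -> X) (w : R * R),
  [/\ continuous phi,
      forall a b : R * R, phi a = phi b <->
        exists m n : int, b = (a.1 + m%:~R, a.2 + n%:~R),
      forall (a : R * R) (z : R -> X), (sol z /\ z 0 = phi a) <->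
        (forall t, z t = phi (a.1 + t * w.1, a.2 + t * w.2))
    & range x `<=` range phi].

Definition rotation_in (J : mat) (U : {vspace vec}) (Om : mat) : Prop :=
  [/\ \dim U = 2, {in U, forall u, J *m u \in U}, Om != 0 &
      exists (a b : vec) (c : R), U = <<[:: a; b]>>%VS /\ Om = c *: wedge a b].

Definition axial (U : {vspace vec}) : Prop := basis 0 \in U.

Definition equatorial (U : {vspace vec}) : Prop :=
  forall u, (u \in U) = (dot (basis 0) u == 0).

Definition D_steady_rotation (J : mat) (plane : {vspace vec} -> Prop)
    (y : R -> mat * mat) : Prop :=
  exists U Om, [/\ plane U, rotation_in J U Om & forall t, (y t).2 = Om].

(* The angular velocity at a point of T*S^2 is that of any point of D lying
   over it. *)
Definition TS_steady_rotation (J : mat) (plane : {vspace vec} -> Prop)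
    (x : R -> vec * vec) : Prop :=
  exists U Om, [/\ plane U, rotation_in J U Om &
    forall t, exists2 g, D (g, Om) & proj J (g, Om) = x t].

Definition equilibrium (X : Type) (x : R -> X) : Prop := forall t, x t = x 0.

Definition reconstructs_to (J : mat) (gam : R -> set (vec * vec))
    (PT : (R -> vec * vec) -> Prop) (PD : (R -> mat * mat) -> Prop) : Prop :=
  (forall x, TS_reconstruction J gam x -> PT x) /\
  (forall y, D_reconstruction J gam y -> PD y).

End VeselovaTop.

Arguments axial {R} U.
Arguments equatorial {R} U.

(* Main.v *)
Require Import Defs.
From mathcomp Require Import all_boot all_order all_algebra.
From mathcomp Require Import all_classical all_reals all_analysis.
From mathcomp Require Import ring lra.
Import Order.TTheory GRing.Theory Num.Theory.
Import numFieldNormedType.Exports.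
Import Defs.
Local Open Scope classical_set_scope.
Local Open Scope ring_scope.

(** Why the theorem holds. For an axisymmetric body the velocity of q takes the
    simple form of [vel], in which only the axial coordinate of q enters
    nonlinearly. Two facts follow. The norm of p and the energy are first
    integrals ([sol_normp], [sol_energy]), and for fixed values of these the axial
    components (q1, p1) form a harmonic oscillator ([sol_axial]). The remaining
    components of q and p solve a linear system driven by this oscillator, whose
    squared Wronskian divided by [den] is constant ([wronskian]). The orientation
    of the planar pair (q2, p2), that is the first component of q x p, is such a
    Wronskian, so its vanishing is invariant; it is nonzero exactly on the
    stratum S3 ([S3P]).

    Where the orientation is nonzero this yields uniqueness of solutions
    ([sol_unique]). After one period of the oscillator the reduced coordinates
    return to their initial values, and the orientation keeps its sign, so the
    state returns up to a rotation about the symmetry axis; by uniqueness the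
    whole solution is then relatively periodic ([relative_period]). If (q1, p1) is
    not zero, the orbit of the solution under rotations is therefore a torus with
    linear flow ([invariant_torus]); it is embedded because the oscillator is not
    at rest and rotations act freely.

    The passage to D rests on one observation: the force on p is normal to the
    sphere, so p, and with it q x p, is parallel along q. The normalised frame
    (q, p, q x p) thus obeys the same transport equation as the attitude g
    ([deriv_frame]), and g is this frame up to a constant element of O(2)
    ([D_solution_is_lift], [D_solution_lift]). Consequently solutions on D are
    images of solutions on the cotangent bundle under an embedding, and tori go to
    tori ([D_quasi_periodic]).

    Let p be nonzero, and either q2 and p2 dependent or (q1, p1) = 0. Then the
    velocity is a constant multiple of p ([vel_parallel]), so the bivector of q
    and p, and with it the angular velocity, is constant ([sol_steady]); the plane
    of q and p contains the axis in the first case and is equatorial in the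
    second. If p = 0 nothing moves. *)

Set Implicit Arguments.
Unset Strict Implicit.

(** * Calculus of vector- and matrix-valued curves *)

Section Calculus.
Variable R : realType.
Implicit Types t : R.

Lemma is_derive_mxP m n (M : R -> 'M[R]_(m.+1, n.+1)) t D :
  is_derive t 1 M D <-> forall i j, is_derive t 1 (fun s => M s i j) (D i j).
Proof.
split=> [[dM MD] i j|dM].
  have /derivable_mxP dMij := dM; apply: DeriveDef; first exact: dMij.
  by rewrite -MD (derive_mx dM) mxE.
have dM' : derivable M t 1.
  by apply/derivable_mxP => i j; case: (dM i j).
apply: DeriveDef => //; rewrite (derive_mx dM'); apply/matrixP => i j.
by rewrite mxE; case: (dM i j).
Qed.

Section normed.
Variable V : normedModType R.
Implicit Types f g : R -> V.

Lemma deriv_cst (v : V) t : is_derive t 1 (fun=> v) 0.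
Proof. exact: is_derive_cst. Qed.

Lemma derivD f g t df dg : is_derive t 1 f df -> is_derive t 1 g dg ->
  is_derive t 1 (fun s => f s + g s) (df + dg).
Proof. by move=> ? ?; exact: is_deriveD. Qed.

Lemma derivB f g t df dg : is_derive t 1 f df -> is_derive t 1 g dg ->
  is_derive t 1 (fun s => f s - g s) (df - dg).
Proof. by move=> ? ?; exact: is_deriveB. Qed.

Lemma derivN f t df : is_derive t 1 f df -> is_derive t 1 (fun s => - f s) (- df).
Proof. by move=> ?; exact: is_deriveN. Qed.

End normed.

Lemma derivM (f g : R -> R) t df dg :
  is_derive t 1 f df -> is_derive t 1 g dg ->
  is_derive t 1 (fun s => f s * g s) (df * g t + f t * dg).
Proof.
move=> fd gd; apply: (is_derive_eq (is_deriveM fd gd)).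
by rewrite /GRing.scale /= addrC [g t * _]mulrC.
Qed.

Lemma derivV (f : R -> R) t df : f t != 0 -> is_derive t 1 f df ->
  is_derive t 1 (fun s => (f s)^-1) (- (f t)^-1 ^+ 2 * df).
Proof.
by move=> f0 fd; apply: (is_derive_eq (is_deriveV f0 fd)); rewrite exprVn.
Qed.

Lemma deriv_sum n (f : 'I_n -> R -> R) (df : 'I_n -> R) t :
  (forall i, is_derive t 1 (f i) (df i)) ->
  is_derive t 1 (fun s => \sum_(i < n) f i s) (\sum_(i < n) df i).
Proof.
move=> fd; have -> : (fun s => \sum_(i < n) f i s) = \sum_(i < n) f i.
  by apply/funext => s; rewrite fct_sumE.
exact: is_derive_sum.
Qed.

Lemma deriv_mulmx m n p (A : R -> 'M[R]_(m.+1, n)) (B : R -> 'M[R]_(n, p.+1))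
    t (dA : 'M[R]_(m.+1, n)) (dB : 'M[R]_(n, p.+1)) :
  (forall i j, is_derive t 1 (fun s => A s i j) (dA i j)) ->
  (forall i j, is_derive t 1 (fun s => B s i j) (dB i j)) ->
  is_derive t 1 (fun s => A s *m B s) (dA *m B t + A t *m dB).
Proof.
move=> Ad Bd; apply/is_derive_mxP => i j; rewrite !mxE -big_split /=.
have -> : (fun s => (A s *m B s) i j) = (fun s => \sum_k A s i k * B s k j).
  by apply/funext => s; rewrite mxE.
by apply: deriv_sum => k; exact: derivM.
Qed.

(** Every constancy argument below ends here: a curve with zero derivative is
    constant, by the mean value theorem applied to each entry. *)
Lemma deriv_cst_eq m n (M : R -> 'M[R]_(m.+1, n.+1)) :
  (forall t, is_derive t 1 M 0) -> forall s t, M s = M t.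
Proof.
move=> M0 s t; apply/matrixP => i j.
apply: (@is_derive_0_is_cst _ (fun u => M u i j)) => u.
by have /is_derive_mxP/(_ i j) := M0 u; rewrite mxE.
Qed.

Lemma deriv_continuous (V : normedModType R) (f : R -> V) (df : R -> V) :
  (forall t, is_derive t 1 f (df t)) -> continuous f.
Proof. by move=> fd t; apply/differentiable_continuous/derivable1_diffP. Qed.

Lemma deriv_comp_shift (V : normedModType R) (f : R -> V) a t d :
  is_derive (t + a) 1 f d -> is_derive t 1 (fun s => f (s + a)) d.
Proof.
have E h : ((fun s => f (s + a)) \o shift t) (h *: 1) = (f \o shift (t + a)) (h *: 1).
  by rewrite /shift /= addrA.
case=> fd fe; have dd : derivable (fun s => f (s + a)) t 1.
  rewrite /derivable; move: fd; rewrite /derivable.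
  by under [X in _ -> cvg (X @ _)]eq_fun do rewrite E.
apply: DeriveDef => //; rewrite -fe /derive.
by under eq_fun do rewrite E.
Qed.

Lemma continuous_mxP (T : topologicalType) m n (M : T -> 'M[R]_(m.+1, n.+1)) :
  (forall i j, continuous (fun x => M x i j)) -> continuous M.
Proof.
move=> cM x; apply/cvgrPdist_le => /= e e0; near=> y.
rewrite /Num.Def.normr/= mx_normrE (bigmax_le _ (ltW e0))//= => i _.
rewrite !mxE/=.
move: i; near: y; apply: filter_forall => /= i.
exact: ((cvgrPdist_le _ _).1 (cM i.1 i.2 x)).
Unshelve. all: by end_near. Qed.

Section continuous.
Variable T : topologicalType.
Implicit Types f g : T -> R.

Lemma contD f g : continuous f -> continuous g -> continuous (fun a => f a + g a).
Proof. by move=> fc gc a; apply: continuousD; [exact: fc|exact: gc]. Qed.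

Lemma contB f g : continuous f -> continuous g -> continuous (fun a => f a - g a).
Proof. by move=> fc gc a; apply: continuousB; [exact: fc|exact: gc]. Qed.

Lemma contM f g : continuous f -> continuous g -> continuous (fun a => f a * g a).
Proof. by move=> fc gc a; apply: continuousM; [exact: fc|exact: gc]. Qed.

Lemma contV f : (forall a, f a != 0) -> continuous f -> continuous (fun a => (f a)^-1).
Proof. by move=> f0 fc a; apply: (@continuousV _ _ f a (f0 a) (fc a)). Qed.

Lemma cont_cst (c : R) : continuous (fun _ : T => c).
Proof. by move=> a; exact: cst_continuous. Qed.

Lemma cont_comp (U V : topologicalType) (f : U -> V) (g : T -> U) :
  continuous f -> continuous g -> continuous (fun a => f (g a)).
Proof. by move=> fc gc a; apply: continuous_comp; [exact: gc|exact: fc]. Qed.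

Lemma cont_pair (U V : topologicalType) (f : T -> U) (g : T -> V) :
  continuous f -> continuous g -> continuous (fun a => (f a, g a)).
Proof. by move=> fc gc a; apply: cvg_pair; [exact: fc|exact: gc]. Qed.

End continuous.

End Calculus.

(** * Linear algebra in three-space *)

Section Space.
Variable R : realType.
Notation vec := 'cV[R]_3.
Notation mat := 'M[R]_3.
Implicit Types (u v w q p : vec) (A B g Om : mat).

Lemma sum3E (V : nmodType) (F : 'I_3 -> V) :
  \sum_(i < 3) F i = F 0 + F 1 + F 2%:R.
Proof.
rewrite !big_ord_recl big_ord0 addr0 addrA.
by congr (_ + F _ + F _); apply: val_inj.
Qed.

Lemma ord3P (P : 'I_3 -> Prop) : P 0 -> P 1 -> P 2%:R -> forall i, P i.
Proof.
move=> P0 P1 P2 [[|[|[|//]]] i3].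
- by rewrite (_ : Ordinal _ = 0) //; apply: val_inj.
- by rewrite (_ : Ordinal _ = 1) //; apply: val_inj.
- by rewrite (_ : Ordinal _ = 2%:R) //; apply: val_inj.
Qed.

Lemma vec3P u v :
  u 0 0 = v 0 0 -> u 1 0 = v 1 0 -> u 2%:R 0 = v 2%:R 0 -> u = v.
Proof. by move=> ? ? ?; apply/matrixP; apply: ord3P => j; rewrite ord1. Qed.

Lemma mat3P A B :
  (forall i, A i 0 = B i 0) -> (forall i, A i 1 = B i 1) ->
  (forall i, A i 2%:R = B i 2%:R) -> A = B.
Proof. by move=> ? ? ?; apply/matrixP => i; apply: ord3P. Qed.

Lemma dotE u v : dot u v = u 0 0 * v 0 0 + u 1 0 * v 1 0 + u 2%:R 0 * v 2%:R 0.
Proof. by rewrite /dot !mxE sum3E !mxE. Qed.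

Lemma mulmxvE A u i :
  (A *m u) i 0 = A i 0 * u 0 0 + A i 1 * u 1 0 + A i 2%:R * u 2%:R 0.
Proof. by rewrite mxE sum3E. Qed.

Lemma wedgeE u v i j : wedge u v i j = u i 0 * v j 0 - v i 0 * u j 0.
Proof. by rewrite /wedge !mxE !big_ord1 !mxE. Qed.

Lemma basisE i j : basis R i j 0 = (j == i)%:R.
Proof. by rewrite mxE eqxx andbT. Qed.

Lemma massE (J1 J2 : R) u i :
  (mass J1 J2 *m u) i 0 = (if i == 0 then J1 else J2) * u i 0.
Proof. by rewrite /mass mul_diag_mx !mxE. Qed.

Definition cross u v : vec := \col_(i < 3)
  [:: u 1 0 * v 2%:R 0 - u 2%:R 0 * v 1 0;
      u 2%:R 0 * v 0 0 - u 0 0 * v 2%:R 0;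
      u 0 0 * v 1 0 - u 1 0 * v 0 0]`_i.

Lemma cross0E u v : cross u v 0 0 = u 1 0 * v 2%:R 0 - u 2%:R 0 * v 1 0.
Proof. by rewrite mxE. Qed.
Lemma cross1E u v : cross u v 1 0 = u 2%:R 0 * v 0 0 - u 0 0 * v 2%:R 0.
Proof. by rewrite mxE. Qed.
Lemma cross2E u v : cross u v 2%:R 0 = u 0 0 * v 1 0 - u 1 0 * v 0 0.
Proof. by rewrite mxE. Qed.
Definition crossE := (cross0E, cross1E, cross2E).

Lemma orthogonal_mulmxT g : orthogonal g -> g *m g^T = 1%:M.
Proof. exact: mulmx1C. Qed.

Lemma orthogonalT g : orthogonal g -> orthogonal g^T.
Proof. by move=> gO; rewrite /orthogonal /= trmxK orthogonal_mulmxT. Qed.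

Lemma orthogonalM g A : orthogonal g -> orthogonal A -> orthogonal (g *m A).
Proof.
by move=> gO AO; rewrite /orthogonal /= trmx_mul mulmxA -(mulmxA A^T) gO mulmx1.
Qed.

Lemma invmx_orthogonal g : orthogonal g -> invmx g = g^T.
Proof.
move=> gO; have gU : g \in unitmx by rewrite -unitmx_tr; case: (mulmx1_unit gO).
by rewrite -[invmx g]mul1mx -gO -mulmxA mulmxV // mulmx1.
Qed.

Lemma bodyT g i : orthogonal g -> body g i = g^T *m basis R i.
Proof. by move=> gO; rewrite /body invmx_orthogonal. Qed.

Lemma dot_orthogonal g u v : orthogonal g -> dot (g *m u) (g *m v) = dot u v.
Proof. by move=> gO; rewrite /dot trmx_mul mulmxA -(mulmxA u^T) gO mulmx1. Qed.

Lemma skew3P Om : skew Om -> [/\ Om 0 0 = 0, Om 1 1 = 0 & Om 2%:R 2%:R = 0] /\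
  [/\ Om 1 0 = - Om 0 1, Om 2%:R 0 = - Om 0 2%:R & Om 2%:R 1 = - Om 1 2%:R].
Proof.
move=> /matrixP Oskew; split; split;
  by [have := Oskew 0 0; have := Oskew 1 1; have := Oskew 2%:R 2%:R;
      rewrite !mxE; lra
     |have := Oskew 0 1; rewrite !mxE; lra
     |have := Oskew 0 2%:R; rewrite !mxE; lra
     |have := Oskew 1 2%:R; rewrite !mxE; lra].
Qed.

Lemma skew_wedge u v : skew (wedge u v).
Proof. by rewrite /skew /= /wedge linearB /= !trmx_mul !trmxK opprB. Qed.

(** An infinitesimal rotation is a derivation of the cross product; this is
    what carries the transport of q and p over to q x p. *)
Lemma skew_cross Om u v : skew Om ->
  Om *m cross u v = cross (Om *m u) v + cross u (Om *m v).
Proof.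
move=> /skew3P [ [m00 m11 m22] [m10 m20 m21]].
by apply: vec3P; rewrite [RHS]mxE !mulmxvE !crossE !mulmxvE;
   rewrite m00 m11 m22 m10 m20 m21; ring.
Qed.

Lemma wedgev u v w : wedge u v *m w = dot v w *: u - dot u w *: v.
Proof. by apply: vec3P; rewrite mulmxvE !wedgeE !dotE !mxE; ring. Qed.

(** A skew matrix of size three that annihilates a given nonzero vector is
    determined up to a factor.
    This turns the vanishing of one vector equation along q into the existence
    of the Lagrange multiplier. *)
Lemma skew_ker_wedge g Z : orthogonal g -> skew Z -> Z *m body g 0 = 0 ->
  exists l : R, Z = l *: wedge (body g 1) (body g 2%:R).
Proof.
move=> gO Zs Z0.
have [W [ZE Ws W0]] :
    exists W, [/\ Z = g^T *m W *m g, skew W & W *m basis R 0 = 0].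
  exists (g *m Z *m g^T); split.
  - by rewrite !mulmxA gO mul1mx -mulmxA gO mulmx1.
  - have ZT : Z^T = - Z by exact: Zs.
    by rewrite /skew /= !trmx_mul trmxK ZT mulNmx mulmxN mulmxA.
  - by rewrite -!mulmxA -bodyT // Z0 mulmx0.
have Wi0 i : W i 0 = 0.
  have /matrixP/(_ i 0) := W0; rewrite mulmxvE !basisE /=.
  by rewrite mulr1 !mulr0 !addr0 => ->; rewrite mxE.
have [ [W00 W11 W22] [W10 W20 W21]] := skew3P Ws.
have WE : W = W 1 2%:R *: wedge (basis R 1) (basis R 2%:R).
  have := Wi0 1; have := Wi0 2%:R; rewrite W10 W20 => W2 W1.
  by apply: mat3P; apply: ord3P;
     rewrite [RHS]mxE wedgeE !basisE ?Wi0 ?W11 ?W22 /= ?W21; lra.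
exists (W 1 2%:R); rewrite {1}ZE {1}WE !bodyT // /wedge.
by rewrite -scalemxAr -scalemxAl mulmxBr mulmxBl !trmx_mul !trmxK !mulmxA.
Qed.

End Space.

(** * The vector field in explicit form *)

Section Field.
Variable R : realType.
Notation vec := 'cV[R]_3.
Notation mat := 'M[R]_3.
Implicit Types (u v w q p : vec) (A B g Om : mat).
Variables (J1 J2 : R).
Hypotheses (J1_gt0 : 0 < J1) (J2_gt0 : 0 < J2).
Local Notation J := (mass J1 J2).

Lemma J12_gt0 : 0 < J1 + J2. Proof. exact: addr_gt0. Qed.
Hint Resolve J12_gt0 : core.

(** The dynamics depends on the inertia through this asymmetry ratio and the
    scale fixed by [den]. *)
Definition asym : R := (J1 - J2) / (J1 + J2).

(** On unit vectors q this is the eigenvalue of the inverse of C on the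
    equatorial plane. *)
Definition den q : R := 2 * J2 + (J1 - J2) * q 0 0 ^+ 2.

(** On the cotangent bundle this is the velocity of q: eliminating the
    projection along q from the formula in terms of C leaves the transverse
    scaling of p and one correction along the tangential part of the symmetry
    axis. In this form the O(2) symmetry is evident. *)
Definition vel q p : vec :=
  (den q)^-1 *: (p + (asym * p 0 0) *: (q 0 0 *: q - basis R 0)).

(** Twice the Hamiltonian. *)
Definition energy q p : R := (den q)^-1 * (dot p p - asym * p 0 0 ^+ 2).

Lemma sqr_coord_le1 q : dot q q = 1 -> q 0 0 ^+ 2 <= 1.
Proof. by rewrite dotE => <-; nra. Qed.

Lemma den_gt0 q : dot q q = 1 -> 0 < den q.
Proof.
move=> /sqr_coord_le1 q1; rewrite /den.
have : 0 <= J1 * q 0 0 ^+ 2 by rewrite mulr_ge0 ?sqr_ge0 // ltW.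
have : 0 <= J2 * (1 - q 0 0 ^+ 2) by rewrite mulr_ge0 ?subr_ge0 // ltW.
have := J2_gt0; lra.
Qed.

Lemma denD_gt0 q : dot q q = 1 -> 0 < den q + (J1 - J2).
Proof.
move=> /sqr_coord_le1 q1; rewrite /den.
have : 0 <= J1 * q 0 0 ^+ 2 by rewrite mulr_ge0 ?sqr_ge0 // ltW.
have : 0 <= J2 * (1 - q 0 0 ^+ 2) by rewrite mulr_ge0 ?subr_ge0 // ltW.
have := J1_gt0; lra.
Qed.

Lemma den_neq0 q : dot q q = 1 -> den q != 0.
Proof. by move=> /den_gt0; rewrite lt0r => /andP[]. Qed.

Lemma dot_mass q : dot q q = 1 -> dot q (J *m q) = J2 + (J1 - J2) * q 0 0 ^+ 2.
Proof.
rewrite !dotE !massE /= => q1.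
have -> : q 2%:R 0 * (J2 * q 2%:R 0) = J2 * (1 - q 0 0 ^+ 2 - q 1 0 ^+ 2).
  by rewrite -q1; ring.
by ring.
Qed.

Lemma CmxE q u i : dot q q = 1 ->
  (Cmx J q *m u) i 0 = (den q + (if i == 0 then J1 - J2 else 0))^-1 * u i 0.
Proof.
move=> q1; have dgt0 := den_gt0 q1.
pose dv : 'rV[R]_3 := \row_i (den q + (if i == 0 then J1 - J2 else 0)).
have d0 j : dv 0 j != 0.
  rewrite mxE lt0r_neq0 //; case: ifP => _; last by rewrite addr0.
  exact: denD_gt0.
have AE : J + (dot q (J *m q))%:M = diag_mx dv.
  apply/matrixP => j k; rewrite dot_mass // !mxE /den; case: eqP => [->|_] /=;
    by case: (_ == k); rewrite ?mulr1n ?mulr0n; ring.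
have ->: Cmx J q = diag_mx (\row_j (dv 0 j)^-1).
  rewrite /Cmx AE.
  have AB : diag_mx dv *m diag_mx (\row_j (dv 0 j)^-1) = 1%:M.
    rewrite mulmx_diag -diag_const_mx; congr diag_mx; apply/rowP => j.
    by have := d0 j; rewrite !mxE => /mulfV.
  have [U _] := mulmx1_unit AB.
  by rewrite -[invmx _]mulmx1 -AB mulKmx.
by rewrite mul_diag_mx !mxE.
Qed.

Lemma qdotE q p : TS (q, p) -> qdot J q p = vel q p.
Proof.
move=> [/= q1 qp]; have dgt0 := den_gt0 q1.
have d2 := lt0r_neq0 (denD_gt0 q1).
have d1 := den_neq0 q1; have s0 := lt0r_neq0 J12_gt0.
have qCq : dot q (Cmx J q *m q) = (J1 + J2) / (den q * (den q + (J1 - J2))).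
  rewrite dotE !CmxE //= addr0.
  have -> : q 2%:R 0 * ((den q)^-1 * q 2%:R 0) =
            (den q)^-1 * (1 - q 0 0 ^+ 2 - q 1 0 ^+ 2).
    by rewrite -q1 dotE; ring.
  rewrite /den in d1 d2 *; field.
  by rewrite d1 d2.
have pCq : dot p (Cmx J q *m q) =
    (J2 - J1) * (p 0 0 * q 0 0) / (den q * (den q + (J1 - J2))).
  rewrite dotE !CmxE //= addr0.
  have -> : p 2%:R 0 * ((den q)^-1 * q 2%:R 0) =
            - (den q)^-1 * (q 0 0 * p 0 0 + q 1 0 * p 1 0).
    have -> : q 0 0 * p 0 0 + q 1 0 * p 1 0 = - (q 2%:R 0 * p 2%:R 0).
      by move: qp; rewrite dotE; lra.
    by ring.
  by field; rewrite d1 d2.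
have mu : dot p (Cmx J q *m q) / dot q (Cmx J q *m q) = - asym * (p 0 0 * q 0 0).
  rewrite pCq qCq /asym; field.
  by rewrite d1 d2 s0.
rewrite /qdot mu; apply: vec3P; rewrite CmxE //= !mxE /= ?addr0; first last.
- by rewrite /asym; field; rewrite d1 s0.
- by rewrite /asym; field; rewrite d1 s0.
rewrite /asym /den in d1 d2 *; field.
by rewrite d1 d2 s0.
Qed.

Lemma dot_vel_q q p : TS (q, p) -> dot q (vel q p) = 0.
Proof.
move=> [/= q1 qp].
have -> : dot q (vel q p) =
    (den q)^-1 * (dot q p + asym * p 0 0 * (q 0 0 * (dot q q - 1))).
  by rewrite !dotE !mxE /=; ring.
by rewrite q1 qp; ring.
Qed.

Lemma dot_vel_p q p : TS (q, p) -> dot (vel q p) p = energy q p.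
Proof.
move=> [/= q1 qp].
have -> : dot (vel q p) p =
    (den q)^-1 * (dot p p + asym * p 0 0 * (q 0 0 * dot q p - p 0 0)).
  by rewrite !dotE !mxE /=; ring.
by rewrite qp /energy; ring.
Qed.

(** The Hamiltonian is half the pairing of p with the velocity. *)
Lemma HamE q p : TS (q, p) -> 2 * Ham J q p = energy q p.
Proof.
move=> qpT; rewrite -dot_vel_p // -qdotE // /Ham /qdot.
rewrite mulrA divff ?pnatr_eq0 // mul1r mulmxBr -scalemxAr.
move: (Cmx J q *m p) (Cmx J q *m q) => a b.
rewrite expr2 mulrAC; move: (dot p b / dot q b) => mu.
by rewrite !dotE !mxE; ring.
Qed.

(** The axial velocity is linear in the axial momentum: the
    dependence on q cancels, which is why the reduced motion is a harmonic
    oscillator. *)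
Lemma vel0 q p : dot q q = 1 -> vel q p 0 0 = p 0 0 / (J1 + J2).
Proof.
move=> q1; rewrite !mxE /= /asym; have := den_neq0 q1; have s0 := lt0r_neq0 J12_gt0.
by rewrite /den => d1; field; rewrite d1 s0.
Qed.

End Field.

(** * First integrals and the transverse linear system *)

Section Solutions.
Variable R : realType.
Notation vec := 'cV[R]_3.
Notation mat := 'M[R]_3.
Implicit Types (w : vec) (A B g Om : mat) (s t : R).
Variables (J1 J2 : R).
Hypotheses (J1_gt0 : 0 < J1) (J2_gt0 : 0 < J2).
Local Notation J := (mass J1 J2).
Local Notation den := (den J1 J2).
Local Notation asym := (asym J1 J2).
Local Notation vel := (vel J1 J2).
Local Notation energy := (energy J1 J2).

Lemma deriv_vec (u : R -> vec) t du i :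
  is_derive t 1 u du -> is_derive t 1 (fun s => u s i 0) (du i 0).
Proof. by move=> /is_derive_mxP. Qed.

Lemma deriv_dot (u v : R -> vec) t du dv :
  is_derive t 1 u du -> is_derive t 1 v dv ->
  is_derive t 1 (fun s => dot (u s) (v s)) (dot du (v t) + dot (u t) dv).
Proof.
move=> ud vd; under eq_fun do rewrite dotE.
have D i := derivM (deriv_vec i ud) (deriv_vec i vd).
apply: (is_derive_eq (derivD (derivD (D 0) (D 1)) (D 2%:R))).
by rewrite !dotE; ring.
Qed.

Section OneSolution.
Variable x : R -> vec * vec.
Hypothesis xsol : TS_solution J x.
Local Notation q t := ((x t).1).
Local Notation p t := ((x t).2).

Lemma sol_TS t : TS (q t, p t).
Proof. by case: (xsol t); case: (x t). Qed.
Hint Resolve sol_TS : core.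

Lemma sol_q t : dot (q t) (q t) = 1. Proof. by case: (sol_TS t). Qed.
Lemma sol_qp t : dot (q t) (p t) = 0. Proof. by case: (sol_TS t). Qed.
Hint Resolve sol_q : core.

Lemma sol_dq t : is_derive t 1 (fun s => q s) (vel (q t) (p t)).
Proof. by case: (xsol t) => _ + _; rewrite qdotE. Qed.

Lemma sol_dp t : is_derive t 1 (fun s => p s) (- energy (q t) (p t) *: q t).
Proof. by case: (xsol t) => _ _; rewrite HamE. Qed.

Lemma sol_normp s t : dot (p s) (p s) = dot (p t) (p t).
Proof.
apply: (@is_derive_0_is_cst _ (fun u => dot (p u) (p u))) => {s t} t.
apply: (is_derive_eq (deriv_dot (sol_dp t) (sol_dp t))).
transitivity (- 2 * energy (q t) (p t) * dot (q t) (p t)); last by rewrite sol_qp mulr0.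
by rewrite !dotE !mxE; ring.
Qed.

Lemma sol_dq0 t : is_derive t 1 (fun s => q s 0 0) (p t 0 0 / (J1 + J2)).
Proof. by rewrite -(vel0 J1_gt0 J2_gt0 _ (sol_q t)); exact/deriv_vec/sol_dq. Qed.

Lemma sol_dp0 t : is_derive t 1 (fun s => p s 0 0) (- energy (q t) (p t) * q t 0 0).
Proof. by have := deriv_vec 0 (sol_dp t); rewrite mxE. Qed.

Lemma sol_dden t :
  is_derive t 1 (fun s => den (q s)) (2 * asym * q t 0 0 * p t 0 0).
Proof.
rewrite /den /=; have D := derivM (sol_dq0 t) (sol_dq0 t).
have -> : (fun s => 2 * J2 + (J1 - J2) * q s 0 0 ^+ 2) =
          (fun s => 2 * J2 + (J1 - J2) * (q s 0 0 * q s 0 0)).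
  by apply/funext => s; rewrite expr2.
apply: (is_derive_eq (derivD (deriv_cst (2 * J2) t)
                             (derivM (deriv_cst (J1 - J2) t) D))).
by rewrite /asym; ring.
Qed.

Lemma sol_dden_inv t : is_derive t 1 (fun s => (den (q s))^-1)
  (- (den (q t))^-1 ^+ 2 * (2 * asym * q t 0 0 * p t 0 0)).
Proof. by apply: derivV (sol_dden t); exact: den_neq0. Qed.

(** The numerator and the denominator of the energy are both quadratic in the
    axial variables, which obey a linear system; their logarithmic derivatives
    agree. *)
Lemma sol_energy s t : energy (q s) (p s) = energy (q t) (p t).
Proof.
apply: (@is_derive_0_is_cst _ (fun u => energy (q u) (p u))) => {s t} t.
rewrite /energy.
have -> : (fun u => (den (q u))^-1 * (dot (p u) (p u) - asym * p u 0 0 ^+ 2)) =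
   (fun u => (den (q u))^-1 * (dot (p t) (p t) - asym * (p u 0 0 * p u 0 0))).
  by apply/funext => s; rewrite expr2 (sol_normp s t).
have D := derivM (sol_dp0 t) (sol_dp0 t).
apply: (is_derive_eq (derivM (sol_dden_inv t)
  (derivB (deriv_cst (dot (p t) (p t)) t) (derivM (deriv_cst asym t) D)))).
by rewrite /energy; ring.
Qed.

(** The components of (q, p) transverse to the symmetry axis solve one linear
    system; the energy being constant, its coefficients vary with the axial
    components only. *)
Definition transverse (a b : R -> R) := forall t,
  is_derive t 1 a ((den (q t))^-1 * (b t + asym * p t 0 0 * q t 0 0 * a t)) /\
  is_derive t 1 b (- energy (q t) (p t) * a t).

Lemma transverseP i : i != 0 -> transverse (fun t => q t i 0) (fun t => p t i 0).
Proof.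
move=> /negbTE i0 t; split.
  have := deriv_vec i (sol_dq t); rewrite !mxE i0 /= => D.
  by apply: (is_derive_eq D); ring.
by have := deriv_vec i (sol_dp t); rewrite mxE.
Qed.

Lemma transverseB a b u v : transverse a b -> transverse u v ->
  transverse (fun t => a t - u t) (fun t => b t - v t).
Proof.
move=> ab uv t; have [ad bd] := ab t; have [ud vd] := uv t; split.
  by apply: (is_derive_eq (derivB ad ud)); ring.
by apply: (is_derive_eq (derivB bd vd)); ring.
Qed.

(** The transverse system has a trace, so its Wronskian is not constant, but
    the trace is half the logarithmic derivative of [den]. Squaring the Wronskian
    absorbs the half. Applied to a solution itself this shows that its orientation
    vanishes always or never; applied to a difference of solutions it gives
    uniqueness. *)
Lemma wronskian a b u v : transverse a b -> transverse u v -> forall s t,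
  (den (q s))^-1 * (a s * v s - b s * u s) ^+ 2 =
  (den (q t))^-1 * (a t * v t - b t * u t) ^+ 2.
Proof.
move=> ab uv s t.
pose W t := a t * v t - b t * u t.
rewrite !expr2.
apply: (@is_derive_0_is_cst _ (fun s => (den (q s))^-1 * (W s * W s))) => {s t} t.
have [ad bd] := ab t; have [ud vd] := uv t.
have Wd : is_derive t 1 W ((den (q t))^-1 * (asym * p t 0 0 * q t 0 0) * W t).
  by apply: (is_derive_eq (derivB (derivM ad vd) (derivM bd ud))); rewrite /W; ring.
apply: (is_derive_eq (derivM (sol_dden_inv t) (derivM Wd Wd))).
by ring.
Qed.

End OneSolution.

Lemma wronskian_eq0 x a b u v : TS_solution J x ->
  transverse x a b -> transverse x u v -> a 0 * v 0 - b 0 * u 0 = 0 ->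
  forall t, a t * v t - b t * u t = 0.
Proof.
move=> xsol ab uv W0 t; have := wronskian xsol ab uv t 0.
rewrite W0 expr0n mulr0 => /eqP; rewrite mulf_eq0 invr_eq0 sqrf_eq0.
by rewrite (negbTE (den_neq0 _ _ (sol_q xsol t))) //= => /eqP.
Qed.

(** In the frame rotating with angular speed [om] the point (u, y) does not
    move. *)
Lemma oscillator (om : R) (u y : R -> R) :
  (forall t, is_derive t 1 u (om * y t)) ->
  (forall t, is_derive t 1 y (- om * u t)) ->
  forall t, u t = u 0 * cos (om * t) + y 0 * sin (om * t) /\
            y t = y 0 * cos (om * t) - u 0 * sin (om * t).
Proof.
move=> ud yd t.
have omd s : is_derive s 1 (fun s => om * s) om.
  by apply: (is_derive_eq (derivM (deriv_cst om s) (is_derive_id s 1))); ring.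
have cd s : is_derive s 1 (fun s => cos (om * s)) (- sin (om * s) * om).
  exact: (is_derive1_comp (is_derive_cos (om * s)) (omd s)).
have sd s : is_derive s 1 (fun s => sin (om * s)) (cos (om * s) * om).
  exact: (is_derive1_comp (is_derive_sin (om * s)) (omd s)).
have aE : u t * cos (om * t) - y t * sin (om * t) = u 0.
  have -> : u 0 = u 0 * cos (om * 0) - y 0 * sin (om * 0).
    by rewrite mulr0 cos0 sin0; ring.
  apply: (@is_derive_0_is_cst _
    (fun t => u t * cos (om * t) - y t * sin (om * t))) => s.
  by apply: (is_derive_eq (derivB (derivM (ud s) (cd s)) (derivM (yd s) (sd s)))); ring.
have bE : u t * sin (om * t) + y t * cos (om * t) = y 0.
  have -> : y 0 = u 0 * sin (om * 0) + y 0 * cos (om * 0).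
    by rewrite mulr0 cos0 sin0; ring.
  apply: (@is_derive_0_is_cst _
    (fun t => u t * sin (om * t) + y t * cos (om * t))) => s.
  by apply: (is_derive_eq (derivD (derivM (ud s) (sd s)) (derivM (yd s) (cd s)))); ring.
have cs := cos2Dsin2 (om * t); rewrite -aE -bE; split.
  transitivity (u t * (cos (om * t) ^+ 2 + sin (om * t) ^+ 2)).
    by rewrite cs mulr1.
  by ring.
transitivity (y t * (cos (om * t) ^+ 2 + sin (om * t) ^+ 2)).
  by rewrite cs mulr1.
by ring.
Qed.

End Solutions.

(** * Angles modulo a full turn *)

Section Angles.
Variable R : realType.
Implicit Types (a b c s : R).

Definition turn : R := pi *+ 2.

Lemma turn_gt0 : 0 < turn. Proof. by rewrite pmulrn_lgt0 // pi_gt0. Qed.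

Lemma cos_sinDturn a (n : int) :
  cos (a + n%:~R * turn) = cos a /\ sin (a + n%:~R * turn) = sin a.
Proof.
have N b m : cos (b + turn *+ m) = cos b /\ sin (b + turn *+ m) = sin b.
  by rewrite (periodicn (@cosD2pi R)) (periodicn (@sinD2pi R)).
case: n => m.
  by have := N a m; rewrite -mulr_natl.
rewrite NegzE mulrNz mulNr; have [+ +] := N (a - turn *+ m.+1) m.+1.
by rewrite subrK -mulr_natl => <- <-.
Qed.

Lemma cos_eq1 a : cos a = 1 -> exists n : int, a = n%:~R * turn.
Proof.
move=> ca; have t0 := turn_gt0; exists (Num.floor (a / turn)).
set n := Num.floor _; pose b := a - n%:~R * turn.
have cb : cos b = 1.
  by have [+ _] := cos_sinDturn b n; rewrite subrK ca.
have b0 : 0 <= b by rewrite subr_ge0 -ler_pdivlMr // floor_le_tmp.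
have b1 : b < turn.
  rewrite ltrBlDl -[X in _ + X]mul1r -mulrDl -ltr_pdivrMr //.
  by have := floorD1_gt (a / turn); rewrite intrD.
suff b00 : b = 0 by apply/eqP; rewrite -subr_eq0 -/b b00.
have inj c : 0 <= c <= pi -> cos c = 1 -> c = 0.
  move=> cpi c1; apply: cos_inj; rewrite ?in_itv //= ?lexx ?pi_ge0 //.
  by rewrite c1 cos0.
have [bpi|bpi] := leP b pi; first by apply: inj => //; rewrite b0.
have /eqP : turn - b = 0.
  apply: inj.
    by move: b1 bpi; rewrite /turn mulr2n => ? ?; apply/andP; split; lra.
  by have [+ _] := cos_sinDturn (- b) 1; rewrite mul1r addrC cosN => ->.
by rewrite subr_eq0 gt_eqF.
Qed.

Lemma eq_cos_sin a b : cos a = cos b -> sin a = sin b ->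
  exists n : int, b = a + n%:~R * turn.
Proof.
move=> cab sab; have [|n nE] := @cos_eq1 (b - a).
  by rewrite cosB cab sab -!expr2 cos2Dsin2.
by exists n; rewrite -nE addrC subrK.
Qed.

Lemma cos_sin_onto c s : c ^+ 2 + s ^+ 2 = 1 -> exists a, cos a = c /\ sin a = s.
Proof.
move=> cs; have c1 : -1 <= c <= 1.
  rewrite -ler_norml -(@ler_pXn2r _ 2) ?nnegrE // expr1n -normrX.
  by rewrite ger0_norm ?sqr_ge0 // -cs lerDl sqr_ge0.
have sE : Num.sqrt (1 - c ^+ 2) = `|s| by rewrite -cs addrAC subrr add0r sqrtr_sqr.
have [s0|s0] := leP 0 s.
  by exists (acos c); rewrite acosK ?in_itv // sin_acos // sE ger0_norm.
exists (- acos c); rewrite cosN sinN acosK ?in_itv // sin_acos // sE.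
by rewrite ltr0_norm // opprK.
Qed.

End Angles.

(** * The group O(2) of orthogonal maps fixing the symmetry axis *)

Section Symmetry.
Variable R : realType.
Notation vec := 'cV[R]_3.
Notation mat := 'M[R]_3.
Implicit Types (u v w q p : vec) (h : mat).

Lemma O2_1 : O2 (1%:M : mat).
Proof. by split; rewrite /orthogonal /= ?trmx1 mul1mx. Qed.

Lemma O2M h k : O2 h -> O2 k -> O2 (h *m k).
Proof.
move=> [hO h0] [kO k0]; split; last by rewrite -mulmxA k0.
exact: orthogonalM.
Qed.

Lemma O2T h : O2 h -> O2 h^T.
Proof.
move=> [hO h0]; split; first exact: orthogonalT.
by rewrite -[in LHS]h0 mulmxA hO mul1mx.
Qed.

Lemma dot_basis u i : dot (basis R i) u = u i 0.
Proof. by move: i; apply: ord3P; rewrite dotE !basisE /=; ring. Qed.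

Lemma O2_axial h u : O2 h -> (h *m u) 0 0 = u 0 0.
Proof. by move=> [hO h0]; rewrite -!dot_basis -[in LHS]h0 dot_orthogonal. Qed.

Definition act h (x : vec * vec) : vec * vec := (h *m x.1, h *m x.2).

Lemma orbit_act h x : O2 h -> O2_orbit (act h x) = O2_orbit x.
Proof.
move=> hO; apply/seteqP; split=> y [k kO <-].
  by exists (k *m h); [exact: O2M|rewrite /= !mulmxA].
have [h1 _] := hO.
exists (k *m h^T); first by apply: O2M => //; exact: O2T.
by rewrite /= !mulmxA -!(mulmxA k) h1 !mul1mx.
Qed.

Lemma orbit_eq x y : O2_orbit x = O2_orbit y -> exists2 h, O2 h & x = act h y.
Proof.
move=> xy; have : O2_orbit x x by exists 1%:M; [exact: O2_1|rewrite !mul1mx; case: (x)].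
by rewrite xy => -[h hO hE]; exists h.
Qed.

Lemma coords_act h x : O2 h -> coords (act h x) = coords x.
Proof.
by move=> hO; rewrite /coords /= !O2_axial // dot_orthogonal //; case: hO.
Qed.

Lemma TS_act h x : O2 h -> TS x -> TS (act h x).
Proof. by move=> [hO _] [x1 x2]; split; rewrite dot_orthogonal. Qed.

Definition rot (a : R) : mat := \matrix_(i < 3, j < 3)
  (nth [::] [:: [:: 1; 0; 0];
                [:: 0; cos a; - sin a];
                [:: 0; sin a; cos a]] i)`_j.

Lemma rotE0 a u : (rot a *m u) 0 0 = u 0 0.
Proof. by rewrite mulmxvE !mxE /=; ring. Qed.
Lemma rotE1 a u : (rot a *m u) 1 0 = cos a * u 1 0 - sin a * u 2%:R 0.
Proof. by rewrite mulmxvE !mxE /=; ring. Qed.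
Lemma rotE2 a u : (rot a *m u) 2%:R 0 = sin a * u 1 0 + cos a * u 2%:R 0.
Proof. by rewrite mulmxvE !mxE /=; ring. Qed.
Definition rotE := (rotE0, rotE1, rotE2).

Lemma rotD a b u : rot (a + b) *m u = rot a *m (rot b *m u).
Proof. by apply: vec3P; rewrite !rotE ?cosD ?sinD //; ring. Qed.

Lemma rotDturn a (n : int) u : rot (a + n%:~R * turn R) *m u = rot a *m u.
Proof.
by have [cE sE] := cos_sinDturn a n; apply: vec3P; rewrite !rotE ?cE ?sE.
Qed.

Lemma rot_O2 a : O2 (rot a).
Proof.
have E (u : vec) : (rot a)^T *m (rot a *m u) = u.
  have cs := cos2Dsin2 a.
  apply: vec3P; rewrite mulmxvE !rotE !mxE /=; first by ring.
    transitivity ((cos a ^+ 2 + sin a ^+ 2) * u 1 0); last by rewrite cs mul1r.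
    by ring.
  transitivity ((cos a ^+ 2 + sin a ^+ 2) * u 2%:R 0); last by rewrite cs mul1r.
  by ring.
split; last by apply: vec3P; rewrite !rotE !basisE /=; ring.
apply/matrixP => i j.
have /matrixP/(_ i 0) := E (delta_mx j 0).
by rewrite mulmxA -colE !mxE eqxx andbT.
Qed.

Lemma cross_rot a u v : cross (rot a *m u) (rot a *m v) 0 0 = cross u v 0 0.
Proof.
transitivity ((cos a ^+ 2 + sin a ^+ 2) * cross u v 0 0).
  by rewrite !cross0E !rotE; ring.
by rewrite cos2Dsin2 mul1r.
Qed.

Lemma act_rot0 x : act (rot 0) x = x.
Proof.
by case: x => u v; congr (_, _); apply: vec3P;
   rewrite !rotE ?cos0 ?sin0 ?mul1r ?mul0r ?subr0 ?add0r.
Qed.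

Lemma actD a b x : act (rot (a + b)) x = act (rot a) (act (rot b) x).
Proof. by rewrite /act /= !rotD. Qed.

(** Lagrange's identity for the planar components: up to sign the orientation
    of a state is a function of its reduced coordinates. *)
Lemma gram_axial q p : TS (q, p) ->
  (cross q p 0 0) ^+ 2 = dot p p * (1 - q 0 0 ^+ 2) - p 0 0 ^+ 2.
Proof.
move=> [/= q1 qp].
have E : q 1 0 * p 1 0 + q 2%:R 0 * p 2%:R 0 = - (q 0 0 * p 0 0).
  by move: qp; rewrite dotE; lra.
have N : q 1 0 ^+ 2 + q 2%:R 0 ^+ 2 = 1 - q 0 0 ^+ 2 by rewrite -q1 dotE; ring.
rewrite cross0E.
transitivity ((q 1 0 ^+ 2 + q 2%:R 0 ^+ 2) * (p 1 0 ^+ 2 + p 2%:R 0 ^+ 2)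
   - (q 1 0 * p 1 0 + q 2%:R 0 * p 2%:R 0) ^+ 2); first by ring.
by rewrite E N dotE; ring.
Qed.

(** Points of the same orbit whose planar pairs are also equally oriented differ
    by a rotation, not only by an element of O(2). The angle is the one from the
    planar momentum p to p'; the planar part of q is then recovered from its
    components along p and orthogonal to p. *)
Lemma rot_transitive q p q' p' : TS (q, p) -> TS (q', p') ->
  q' 0 0 = q 0 0 -> p' 0 0 = p 0 0 -> dot p' p' = dot p p ->
  cross q' p' 0 0 = cross q p 0 0 -> cross q p 0 0 != 0 ->
  exists a, (q', p') = act (rot a) (q, p).
Proof.
move=> [/= q1 qp] [/= q1' qp'] q0 p0 P; rewrite !cross0E => L L0.
have {}L0 : p 1 0 ^+ 2 + p 2%:R 0 ^+ 2 != 0.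
  apply: contra L0; rewrite paddr_eq0 ?sqr_ge0 // !sqrf_eq0 => /andP[/eqP-> /eqP->].
  by rewrite !mulr0 subrr.
have {P} N : p' 1 0 ^+ 2 + p' 2%:R 0 ^+ 2 = p 1 0 ^+ 2 + p 2%:R 0 ^+ 2.
  by move: P; rewrite !dotE p0; lra.
have {qp qp'} M : q' 1 0 * p' 1 0 + q' 2%:R 0 * p' 2%:R 0 =
                  q 1 0 * p 1 0 + q 2%:R 0 * p 2%:R 0.
  by move: qp qp'; rewrite !dotE p0 q0; lra.
set n := p 1 0 ^+ 2 + p 2%:R 0 ^+ 2 in L0 N.
pose c := (p 1 0 * p' 1 0 + p 2%:R 0 * p' 2%:R 0) / n.
pose s := (p 1 0 * p' 2%:R 0 - p 2%:R 0 * p' 1 0) / n.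
have cs : c ^+ 2 + s ^+ 2 = 1.
  transitivity ((p' 1 0 ^+ 2 + p' 2%:R 0 ^+ 2) / n); last by rewrite N divff.
  by rewrite /c /s /n in L0 *; field.
have [a [ca sa]] := cos_sin_onto cs.
have pE1 : p' 1 0 = c * p 1 0 - s * p 2%:R 0.
  by rewrite /c /s /n in L0 *; field.
have pE2 : p' 2%:R 0 = s * p 1 0 + c * p 2%:R 0.
  by rewrite /c /s /n in L0 *; field.
exists a; congr (_, _); apply: vec3P; rewrite !rotE ?ca ?sa //.
- apply: (mulfI L0); rewrite -[in LHS]N.
  transitivity ((q' 1 0 * p' 1 0 + q' 2%:R 0 * p' 2%:R 0) * p' 1 0 +
    (q' 1 0 * p' 2%:R 0 - q' 2%:R 0 * p' 1 0) * p' 2%:R 0); first by ring.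
  by rewrite L M pE1 pE2 /n; ring.
- apply: (mulfI L0); rewrite -[in LHS]N.
  transitivity ((q' 1 0 * p' 1 0 + q' 2%:R 0 * p' 2%:R 0) * p' 2%:R 0 -
    (q' 1 0 * p' 2%:R 0 - q' 2%:R 0 * p' 1 0) * p' 1 0); first by ring.
  by rewrite L M pE1 pE2 /n; ring.
Qed.

End Symmetry.

(** * The axial oscillation and uniqueness of solutions *)

Section Torus.
Variable R : realType.
Notation vec := 'cV[R]_3.
Notation mat := 'M[R]_3.
Implicit Types (q p : vec) (h : mat) (s t a : R).
Variables (J1 J2 : R).
Hypotheses (J1_gt0 : 0 < J1) (J2_gt0 : 0 < J2).
Local Notation J := (mass J1 J2).
Local Notation den := (den J1 J2).
Local Notation asym := (asym J1 J2).
Local Notation vel := (vel J1 J2).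
Local Notation energy := (energy J1 J2).

Lemma TS_solutionP (x : R -> vec * vec) : TS_solution J x <->
  forall t, [/\ TS (x t), is_derive t 1 (fun s => (x s).1) (vel (x t).1 (x t).2) &
    is_derive t 1 (fun s => (x s).2) (- energy (x t).1 (x t).2 *: (x t).1)].
Proof.
have E t : TS (x t) -> TS ((x t).1, (x t).2) by case: (x t).
by split=> xsol t; have [xT xq xp] := xsol t; split=> //;
  rewrite ?qdotE ?HamE // in xq xp *; try exact: E.
Qed.

Lemma vel_act h q p : O2 h -> vel (h *m q) (h *m p) = h *m vel q p.
Proof.
move=> hO; rewrite /vel /den !O2_axial // -scalemxAr mulmxDr -scalemxAr.
by rewrite mulmxBr -scalemxAr; case: hO => _ ->.
Qed.

Lemma energy_act h q p : O2 h -> energy (h *m q) (h *m p) = energy q p.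
Proof.
by move=> hO; rewrite /energy /den !O2_axial // dot_orthogonal //; case: hO.
Qed.

Lemma deriv_mull h (u : R -> vec) t du : is_derive t 1 u du ->
  is_derive t 1 (fun s => h *m u s) (h *m du).
Proof.
move=> /is_derive_mxP ud.
have hd (i j : 'I_3) : is_derive t 1 (fun=> h i j) ((0 : mat) i j).
  by rewrite mxE; exact: deriv_cst.
by apply: (is_derive_eq (deriv_mulmx hd ud)); rewrite mul0mx add0r.
Qed.

Lemma TS_solution_act h x : O2 h -> TS_solution J x ->
  TS_solution J (fun t => act h (x t)).
Proof.
move=> hO /TS_solutionP xsol; apply/TS_solutionP => t; have [xT xq xp] := xsol t.
split; first exact: TS_act.
  by rewrite vel_act //; exact: deriv_mull.
by rewrite energy_act // scalemxAr; exact: deriv_mull.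
Qed.

Lemma TS_solution_shift x a : TS_solution J x -> TS_solution J (fun t => x (t + a)).
Proof.
move=> xsol t; have [xT xq xp] := xsol (t + a); split => //.
  exact: (deriv_comp_shift xq).
exact: (deriv_comp_shift xp).
Qed.

(** The ratio [asym] is less than one, and the axial momentum is at most the
    total one. *)
Lemma energy_gt0 q p : TS (q, p) -> 0 < dot p p -> 0 < energy q p.
Proof.
move=> [/= q1 qp] P0; rewrite /energy mulr_gt0 ?invr_gt0 ?den_gt0 //.
have s0 := addr_gt0 J1_gt0 J2_gt0.
have p0 : p 0 0 ^+ 2 <= dot p p.
  by rewrite dotE -!expr2 -addrA lerDl addr_ge0 ?sqr_ge0.
have asym1 : asym <= 1 by rewrite /asym ler_pdivrMr //; have := J2_gt0; lra.
have asym2 : asym != 1.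
  by rewrite /asym; apply/eqP => /(divr1_eq); have := J2_gt0; lra.
have {}asym1 : asym < 1 by rewrite lt_neqAle asym2.
rewrite subr_gt0; have [k0|k0] := leP asym 0.
  by apply: le_lt_trans P0; rewrite mulr_le0_ge0 ?sqr_ge0.
apply: (@le_lt_trans _ _ (asym * dot p p)); first by rewrite ler_pM2l.
by rewrite gtr_pMl.
Qed.

Lemma oriented_normp_gt0 q p : TS (q, p) -> cross q p 0 0 != 0 -> 0 < dot p p.
Proof.
move=> qpT L0; rewrite lt_neqAle eq_sym; apply/andP; split.
  apply: contra L0 => /eqP P0; rewrite -sqrf_eq0 gram_axial //.
  have p0 : p 0 0 ^+ 2 <= 0.
    by rewrite -P0 dotE -!expr2 -addrA lerDl addr_ge0 ?sqr_ge0.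
  have /eqP -> : p 0 0 == 0 by rewrite -sqrf_eq0 eq_le p0 sqr_ge0.
  by rewrite P0 mul0r expr0n subrr.
by rewrite dotE -!expr2 !addr_ge0 ?sqr_ge0.
Qed.

Definition freq q p : R := Num.sqrt (energy q p / (J1 + J2)).

Lemma freq_gt0 q p : TS (q, p) -> 0 < dot p p -> 0 < freq q p.
Proof.
by move=> qpT P0; rewrite sqrtr_gt0 divr_gt0 ?energy_gt0 ?addr_gt0.
Qed.

Lemma sqr_freq q p : TS (q, p) -> 0 < dot p p ->
  (J1 + J2) * freq q p ^+ 2 = energy q p.
Proof.
move=> qpT P0; have s0 := addr_gt0 J1_gt0 J2_gt0.
rewrite sqr_sqrtr; first by rewrite mulrC divfK // lt0r_neq0.
by rewrite divr_ge0 ?ltW // energy_gt0.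
Qed.

Section Axial.
Variable x : R -> vec * vec.
Hypothesis xsol : TS_solution J x.
Local Notation q t := ((x t).1).
Local Notation p t := ((x t).2).
Hypothesis P_gt0 : 0 < dot (p 0) (p 0).
Local Notation om := (freq (q 0) (p 0)).
Local Notation sg := ((J1 + J2) * om).

Lemma sol_freq_gt0 : 0 < om.
Proof. exact: (freq_gt0 (sol_TS xsol 0)). Qed.

(** The axial momentum is divided by the scale that makes the two equations of
    the oscillator symmetric. *)
Lemma sol_axial t :
  q t 0 0 = q 0 0 0 * cos (om * t) + p 0 0 0 / sg * sin (om * t) /\
  p t 0 0 / sg = p 0 0 0 / sg * cos (om * t) - q 0 0 0 * sin (om * t).
Proof.
have om0 := sol_freq_gt0; have s0 := addr_gt0 J1_gt0 J2_gt0.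
apply: (@oscillator _ om (fun t => q t 0 0) (fun t => p t 0 0 / sg)) => {}t.
  apply: (is_derive_eq (sol_dq0 J1_gt0 J2_gt0 xsol t)).
  by field; rewrite !lt0r_neq0.
apply: (is_derive_eq (derivM (sol_dp0 J1_gt0 J2_gt0 xsol t) (deriv_cst (sg^-1) t))).
rewrite (sol_energy J1_gt0 J2_gt0 xsol t 0) -(sqr_freq (sol_TS xsol 0)) //.
by field; rewrite !lt0r_neq0.
Qed.

End Axial.

(** The orientation of a solution is the Wronskian of its own two transverse
    components. *)
Lemma sol_crossE x : TS_solution J x -> forall s t,
  (den (x s).1)^-1 * cross (x s).1 (x s).2 0 0 ^+ 2 =
  (den (x t).1)^-1 * cross (x t).1 (x t).2 0 0 ^+ 2.
Proof.
move=> xsol s t.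
have E u : cross (x u).1 (x u).2 0 0 =
    (x u).1 1 0 * (x u).2 2%:R 0 - (x u).2 1 0 * (x u).1 2%:R 0.
  by rewrite cross0E; ring.
have [n1 n2] : (1 : 'I_3) != 0 /\ (2%:R : 'I_3) != 0 by [].
rewrite !E; apply: (wronskian J1_gt0 J2_gt0 xsol (transverseP J1_gt0 J2_gt0 xsol n1)
  (transverseP J1_gt0 J2_gt0 xsol n2)).
Qed.

Lemma sol_cross_eq0 x : TS_solution J x -> forall s t,
  (cross (x s).1 (x s).2 0 0 == 0) = (cross (x t).1 (x t).2 0 0 == 0).
Proof.
move=> xsol s t; have := congr1 (eq_op ^~ 0) (sol_crossE xsol s t).
rewrite /= !mulf_eq0 !invr_eq0 !orbb.
by rewrite !(negbTE (den_neq0 _ _ (sol_q xsol _))).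
Qed.

(** Axial components agree because the oscillator is solved explicitly. The
    difference of the transverse components solves the same linear system and
    starts at zero, so its Wronskians with the two transverse components of x
    vanish; these two are linearly independent. *)
Lemma sol_unique x z : TS_solution J x -> TS_solution J z ->
  cross (x 0).1 (x 0).2 0 0 != 0 -> z 0 = x 0 -> forall t, z t = x t.
Proof.
move=> xsol zsol L0 zx0 t.
have P0 := oriented_normp_gt0 (sol_TS xsol 0) L0.
have om0 := sol_freq_gt0 xsol P0; have s0 := addr_gt0 J1_gt0 J2_gt0.
have ax s : (z s).1 0 0 = (x s).1 0 0 /\ (z s).2 0 0 = (x s).2 0 0.
  have [xq xp] := sol_axial xsol P0 s.
  have [|zq zp] := @sol_axial z zsol _ s; first by rewrite zx0.
  rewrite zx0 in zq zp; split; first by rewrite zq xq.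
  have sg0 : ((J1 + J2) * freq (x 0).1 (x 0).2)^-1 != 0.
    by rewrite invr_eq0 mulf_neq0 ?lt0r_neq0.
  by apply: (mulIf sg0); rewrite zp xp.
have tr i : i != 0 -> transverse J1 J2 x (fun s => (z s).1 i 0 - (x s).1 i 0)
                                         (fun s => (z s).2 i 0 - (x s).2 i 0).
  move=> i0; apply: transverseB; last exact: transverseP.
  move=> s; have [zq zp] := transverseP J1_gt0 J2_gt0 zsol i0 s.
  have [q0 p0] := ax s; move: zq zp; rewrite /den p0 q0.
  rewrite (sol_energy J1_gt0 J2_gt0 zsol s 0) zx0.
  by rewrite (sol_energy J1_gt0 J2_gt0 xsol 0 s).
have W i j : i != 0 -> j != 0 ->
    (x t).1 i 0 * ((z t).2 j 0 - (x t).2 j 0) -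
    (x t).2 i 0 * ((z t).1 j 0 - (x t).1 j 0) = 0.
  move=> i0 j0; apply: (wronskian_eq0 J1_gt0 J2_gt0 xsol
    (transverseP J1_gt0 J2_gt0 xsol i0) (tr j j0)).
  by rewrite zx0 !subrr !mulr0 subrr.
have Lt : cross (x t).1 (x t).2 0 0 != 0 by rewrite (sol_cross_eq0 xsol t 0).
have Z i : i != 0 -> (z t).1 i 0 = (x t).1 i 0 /\ (z t).2 i 0 = (x t).2 i 0.
  move=> i0; have W1 := W 1 i isT i0; have W2 := W 2%:R i isT i0.
  pose v := (z t).2 i 0 - (x t).2 i 0; pose w := (z t).1 i 0 - (x t).1 i 0.
  rewrite -/v -/w in W1 W2.
  rewrite cross0E in Lt; split; apply/eqP; rewrite -subr_eq0 -(mulrI_eq0 _ (mulfI Lt)).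
    (* Cramer's rule in the basis of the two transverse components *)
    apply/eqP; rewrite -/w.
    transitivity ((x t).1 2%:R 0 * ((x t).1 1 0 * v - (x t).2 1 0 * w)
      - (x t).1 1 0 * ((x t).1 2%:R 0 * v - (x t).2 2%:R 0 * w)); first by ring.
    by rewrite W1 W2; ring.
  apply/eqP; rewrite -/v.
  transitivity ((x t).2 2%:R 0 * ((x t).1 1 0 * v - (x t).2 1 0 * w)
    - (x t).2 1 0 * ((x t).1 2%:R 0 * v - (x t).2 2%:R 0 * w)); first by ring.
  by rewrite W1 W2; ring.
have [q0 p0] := ax t; have [q1 p1] := Z 1 isT; have [q2 p2] := Z 2%:R isT.
rewrite [LHS]surjective_pairing [RHS]surjective_pairing; congr (_, _); exact: vec3P.
Qed.

End Torus.

(** * Invariant tori in the cotangent bundle *)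

Section QuasiPeriodic.
Variable R : realType.
Notation vec := 'cV[R]_3.
Notation mat := 'M[R]_3.
Implicit Types (q p : vec) (h : mat) (s t : R).
Variables (J1 J2 : R).
Hypotheses (J1_gt0 : 0 < J1) (J2_gt0 : 0 < J2).
Local Notation J := (mass J1 J2).
Variable x : R -> vec * vec.
Hypothesis xsol : TS_solution J x.
Hypothesis L_neq0 : cross (x 0).1 (x 0).2 0 0 != 0.
Local Notation q t := ((x t).1).
Local Notation p t := ((x t).2).
Local Notation om := (freq J1 J2 (q 0) (p 0)).
Local Notation T := (turn R / om).

Let P_gt0 : 0 < dot (p 0) (p 0).
Proof. exact: oriented_normp_gt0 (sol_TS xsol 0) L_neq0. Qed.

Let om_gt0 : 0 < om.
Proof. exact: sol_freq_gt0. Qed.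

Let T_gt0 : 0 < T. Proof. by rewrite divr_gt0 // turn_gt0. Qed.

Let sg_neq0 : ((J1 + J2) * om)^-1 != 0.
Proof. by rewrite invr_eq0 mulf_neq0 // lt0r_neq0 // addr_gt0. Qed.

Lemma sol_cross_neq0 t : cross (q t) (p t) 0 0 != 0.
Proof. by rewrite (sol_cross_eq0 J1_gt0 J2_gt0 xsol t 0). Qed.

Lemma cross_continuous : continuous (fun t => cross (q t) (p t) 0 0).
Proof.
have D t i := deriv_vec i (sol_dq J1_gt0 J2_gt0 xsol t).
have D' t i := deriv_vec i (sol_dp J1_gt0 J2_gt0 xsol t).
have -> : (fun t => cross (q t) (p t) 0 0) =
  (fun t => q t 1 0 * p t 2%:R 0 - q t 2%:R 0 * p t 1 0).
  by apply/funext => t; rewrite cross0E.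
exact: deriv_continuous (fun t => derivB (derivM (D t 1) (D' t 2%:R))
                                         (derivM (D t 2%:R) (D' t 1))).
Qed.

(** The orientation cannot change sign, since it is continuous and never
    vanishes. *)
Lemma sol_cross_sign t : 0 < cross (q t) (p t) 0 0 * cross (q 0) (p 0) 0 0.
Proof.
rewrite ltNge; apply/negP => neg.
pose L s := cross (q s) (p s) 0 0 * cross (q 0) (p 0) 0 0.
have Lc : continuous L.
  by apply: contM; [exact: cross_continuous|exact: cont_cst].
have L0 : 0 <= L 0 by rewrite /L -expr2 sqr_ge0.
have [c Lc0] : exists c, L c = 0.
  have [t0|t0] := leP 0 t.
    have [||c _ cE] := @IVT _ L 0 t 0 t0;
      [exact: continuous_subspaceT| |by exists c].
    by rewrite ge_min le_max L0 neg orbT.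
  have [||c _ cE] := @IVT _ L t 0 0 (ltW t0);
    [exact: continuous_subspaceT| |by exists c].
  by rewrite ge_min le_max L0 neg orbT.
move/eqP: Lc0; rewrite mulf_eq0 (negbTE L_neq0) orbF.
by rewrite (negbTE (sol_cross_neq0 c)).
Qed.

Lemma cos_sin_period t (n : int) :
  cos (om * (t + n%:~R * T)) = cos (om * t) /\
  sin (om * (t + n%:~R * T)) = sin (om * t).
Proof.
have -> : om * (t + n%:~R * T) = om * t + n%:~R * turn R by field; rewrite lt0r_neq0.
exact: cos_sinDturn.
Qed.

Lemma axial_period t (n : int) :
  q (t + n%:~R * T) 0 0 = q t 0 0 /\ p (t + n%:~R * T) 0 0 = p t 0 0.
Proof.
have [qE pE] := sol_axial J1_gt0 J2_gt0 xsol P_gt0 t.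
have [qTE pTE] := sol_axial J1_gt0 J2_gt0 xsol P_gt0 (t + n%:~R * T).
have [cE sE] := cos_sin_period t n; rewrite cE sE in qTE pTE.
by split; [rewrite qTE qE|apply: (mulIf sg_neq0); rewrite pTE pE].
Qed.

(** After a period of the axial oscillator the state comes back up to a
    rotation about the symmetry axis, hence so does the whole solution. *)
Lemma relative_period : exists dl, forall t, x (t + T) = act (rot dl) (x t).
Proof.
have [q0E p0E] := axial_period 0 1; rewrite mul1r add0r in q0E p0E.
have xT := sol_TS xsol T; have x0 := sol_TS xsol 0.
have PE := sol_normp J1_gt0 J2_gt0 xsol T 0.
have LE : cross (q T) (p T) 0 0 = cross (q 0) (p 0) 0 0.
  apply/eqP; have := sol_cross_sign T.
  have /eqP : cross (q T) (p T) 0 0 ^+ 2 = cross (q 0) (p 0) 0 0 ^+ 2.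
    by rewrite !gram_axial // q0E p0E PE.
  rewrite eqf_sqr => /orP[//|/eqP ->]; rewrite mulNr oppr_gt0 -expr2.
  by rewrite ltNge sqr_ge0.
have [dl dlE] := rot_transitive x0 xT q0E p0E PE LE L_neq0.
exists dl => t.
have rO := rot_O2 dl.
apply: (@sol_unique _ _ _ J1_gt0 J2_gt0
  (fun t => act (rot dl) (x t)) (fun t => x (t + T))).
- exact: TS_solution_act.
- exact: TS_solution_shift.
- by rewrite cross_rot.
- by rewrite add0r [LHS]surjective_pairing dlE; case: (x 0).
Qed.

Lemma multiple_period dl : (forall t, x (t + T) = act (rot dl) (x t)) ->
  forall (n : int) t, x (t + n%:~R * T) = act (rot (n%:~R * dl)) (x t).
Proof.
move=> per.
have N (n : nat) t : x (t + n%:R * T) = act (rot (n%:R * dl)) (x t).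
  elim: n t => [|n IH] t; first by rewrite !mul0r addr0 act_rot0.
  have -> : t + n.+1%:R * T = (t + n%:R * T) + T by rewrite -natr1 mulrDl mul1r addrA.
  by rewrite per IH -actD -natr1 mulrDl mul1r addrC.
move=> [n|n] t; first exact: N.
rewrite NegzE mulrNz !mulNr; have := N n.+1 (t - n.+1%:R * T).
by rewrite subrK => ->; rewrite -actD addNr act_rot0.
Qed.

(** The second angle runs along the solution, in units of the period of the
    axial oscillator; the rotation by [- dl * a.2] undoes the drift accumulated
    over a period, so that the map descends to the torus. *)
Definition torus (dl : R) (a : R * R) : vec * vec :=
  act (rot (turn R * a.1 - dl * a.2)) (x (T * a.2)).

Lemma torus_continuous dl : continuous (torus dl).
Proof.
have xc i : continuous (fun t => q t i 0) /\ continuous (fun t => p t i 0).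
  split; [apply: deriv_continuous => t|apply: deriv_continuous => t].
    exact: (deriv_vec i (sol_dq J1_gt0 J2_gt0 xsol t)).
  exact: (deriv_vec i (sol_dp J1_gt0 J2_gt0 xsol t)).
have c1 : continuous (fun a : R * R => a.1) by move=> a; exact: cvg_fst.
have c2 : continuous (fun a : R * R => a.2) by move=> a; exact: cvg_snd.
have ac : continuous (fun a : R * R => turn R * a.1 - dl * a.2).
  by apply: contB; apply: contM => //; exact: cont_cst.
have tc : continuous (fun a : R * R => T * a.2).
  by apply: contM => //; exact: cont_cst.
have vc (y : R -> vec) : (forall i, continuous (fun t => y t i 0)) ->
    continuous (fun a : R * R => rot (turn R * a.1 - dl * a.2) *m y (T * a.2)).
  move=> yc; apply: continuous_mxP => i j; rewrite (ord1 j).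
  have C := cont_comp (@continuous_cos R) ac.
  have S := cont_comp (@continuous_sin R) ac.
  have Y k := cont_comp (yc k) tc.
  move: i; apply: ord3P; under eq_fun do rewrite rotE.
  - exact: Y.
  - by apply: contB; exact: contM.
  - by apply: contD; exact: contM.
apply: cont_pair.
  by apply: (vc (fun t => q t)) => i; case: (xc i).
by apply: (vc (fun t => p t)) => i; case: (xc i).
Qed.

Lemma torus_flow dl a t : torus dl (a.1 + t * (dl / (turn R * T)), a.2 + t * T^-1) =
  act (rot (turn R * a.1 - dl * a.2)) (x (t + T * a.2)).
Proof.
have tn := lt0r_neq0 (turn_gt0 R); have on := lt0r_neq0 om_gt0.
rewrite /torus /=; congr (act (rot _) (x _));
  move: (turn R) (freq _ _ _ _) tn on => tau w tn on; field; by rewrite ?tn ?on.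
Qed.

(** A nonzero point of the axial phase plane moves on an ellipse and visits
    each of its points once per period. *)
Lemma axial_injective s t :
  (q 0 0 0, p 0 0 0) <> (0, 0) -> q s 0 0 = q t 0 0 -> p s 0 0 = p t 0 0 ->
  exists n : int, t = s + n%:~R * T.
Proof.
move=> qp0 qst pst.
have [qs ps] := sol_axial J1_gt0 J2_gt0 xsol P_gt0 s.
have [qt pt] := sol_axial J1_gt0 J2_gt0 xsol P_gt0 t.
rewrite qst in qs; rewrite pst in ps.
set a := q 0 0 0 in qs ps qt pt qp0; set b := p 0 0 0 / _ in qs ps qt pt.
have ab : a ^+ 2 + b ^+ 2 != 0.
  rewrite paddr_eq0 ?sqr_ge0 // !sqrf_eq0; apply/negP => /andP[/eqP a0].
  rewrite /b mulf_eq0 (negbTE sg_neq0) orbF => /eqP p0.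
  by apply: qp0; rewrite a0 p0.
have C : cos (om * s) = cos (om * t).
  apply: (mulfI ab).
  transitivity (a * (a * cos (om * s) + b * sin (om * s)) +
                b * (b * cos (om * s) - a * sin (om * s))); first by ring.
  by rewrite -qs -ps qt pt; ring.
have S : sin (om * s) = sin (om * t).
  apply: (mulfI ab).
  transitivity (b * (a * cos (om * s) + b * sin (om * s)) -
                a * (b * cos (om * s) - a * sin (om * s))); first by ring.
  by rewrite -qs -ps qt pt; ring.
have [n nE] := eq_cos_sin C S; exists n.
have on := lt0r_neq0 om_gt0; apply: (mulfI on); rewrite nE; field.
by rewrite on.
Qed.

(** The planar part of q does not vanish, and only the identity rotation fixes
    a nonzero vector of the plane. *)
Lemma rot_free a b t : act (rot a) (x t) = act (rot b) (x t) ->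
  exists n : int, b = a + n%:~R * turn R.
Proof.
case=> qE _.
have N : q t 1 0 ^+ 2 + q t 2%:R 0 ^+ 2 != 0.
  rewrite paddr_eq0 ?sqr_ge0 // !sqrf_eq0; apply/negP => /andP[/eqP q1 /eqP q2].
  have := sol_cross_neq0 t; rewrite cross0E q1 q2.
  by rewrite !mul0r subrr eqxx.
have E1 : cos a * q t 1 0 - sin a * q t 2%:R 0 = cos b * q t 1 0 - sin b * q t 2%:R 0.
  by rewrite -!rotE1 qE.
have E2 : sin a * q t 1 0 + cos a * q t 2%:R 0 = sin b * q t 1 0 + cos b * q t 2%:R 0.
  by rewrite -!rotE2 qE.
apply: eq_cos_sin; apply: (mulIf N).
  transitivity (q t 1 0 * (cos a * q t 1 0 - sin a * q t 2%:R 0) +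
                q t 2%:R 0 * (sin a * q t 1 0 + cos a * q t 2%:R 0)); first by ring.
  by rewrite E1 E2; ring.
transitivity (q t 1 0 * (sin a * q t 1 0 + cos a * q t 2%:R 0) -
              q t 2%:R 0 * (cos a * q t 1 0 - sin a * q t 2%:R 0)); first by ring.
by rewrite E1 E2; ring.
Qed.

Lemma torus_injective dl : (forall t, x (t + T) = act (rot dl) (x t)) ->
  (q 0 0 0, p 0 0 0) <> (0, 0) -> forall a b, torus dl a = torus dl b <->
  exists m n : int, b = (a.1 + m%:~R, a.2 + n%:~R).
Proof.
move=> per qp0 a b; have tn := lt0r_neq0 (turn_gt0 R); have Tn := lt0r_neq0 T_gt0.
have shift m n : torus dl (a.1 + m, a.2 + n%:~R) =
    act (rot (turn R * a.1 + turn R * m - dl * a.2)) (x (T * a.2)).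
  rewrite /torus /= !mulrDr [T * n%:~R]mulrC (multiple_period per) -actD.
  by congr (act (rot _) _); ring.
split=> [abE|[m [n ->]]]; last first.
  rewrite shift /torus; set y := x _.
  have -> : turn R * a.1 + turn R * m%:~R - dl * a.2 =
            (turn R * a.1 - dl * a.2) + m%:~R * turn R by ring.
  by rewrite /act !rotDturn.
have [n nE] : exists n : int, T * b.2 = T * a.2 + n%:~R * T.
  by move: abE => -[/matrixP/(_ 0 0) + /matrixP/(_ 0 0)]; rewrite !rotE0;
     exact: axial_injective.
have b2 : b.2 = a.2 + n%:~R by apply: (mulfI Tn); rewrite nE; ring.
have := shift (b.1 - a.1) n; rewrite addrC subrK -b2 -surjective_pairing -abE.
move=> /rot_free[m mE]; exists m, n.
rewrite -b2 [LHS]surjective_pairing; congr (_, _).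
by apply: (mulfI tn); rewrite -[LHS](addrK (- (dl * a.2))); lra.
Qed.

(** The last clause keeps track of the momentum, which is constant on the
    torus; it fixes the normalisation of the frame used to lift the torus to
    D. *)
Lemma invariant_torus : (q 0 0 0, p 0 0 0) <> (0, 0) ->
  exists (phi : R * R -> vec * vec) (w : R * R),
  [/\ continuous phi,
      forall a b : R * R, phi a = phi b <->
        exists m n : int, b = (a.1 + m%:~R, a.2 + n%:~R),
      forall (a : R * R) (z : R -> vec * vec), (TS_solution J z /\ z 0 = phi a) <->
        (forall t, z t = phi (a.1 + t * w.1, a.2 + t * w.2)),
      range x `<=` range phi &
      forall a, dot (phi a).2 (phi a).2 = dot (p 0) (p 0)].
Proof.
move=> qp0; have [dl per] := relative_period.
exists (torus dl), (dl / (turn R * T), T^-1); split.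
- exact: torus_continuous.
- exact: torus_injective.
- move=> a z; have flow := torus_flow dl a.
  have sol := TS_solution_act J1_gt0 J2_gt0 (rot_O2 (turn R * a.1 - dl * a.2))
                (TS_solution_shift (T * a.2) xsol).
  split=> [[zsol z0] t|zE].
    rewrite flow; apply: (sol_unique J1_gt0 J2_gt0 sol zsol).
      by rewrite cross_rot add0r sol_cross_neq0.
    by rewrite z0 add0r.
  have -> : z = fun t => act (rot (turn R * a.1 - dl * a.2)) (x (t + T * a.2)).
    by apply/funext => t; rewrite zE flow.
  by split=> //; rewrite add0r.
- move=> _ [t _ <-]; exists (t * (dl / (turn R * T)), t * T^-1) => //.
  have := torus_flow dl (0, 0) t; rewrite /= !add0r => ->.
  by rewrite !mulr0 subr0 addr0 act_rot0.
- move=> a; rewrite dot_orthogonal; last by case: (rot_O2 (turn R * a.1 - dl * a.2)).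
  exact: (sol_normp J1_gt0 J2_gt0 xsol _ 0).
Qed.

End QuasiPeriodic.

(** * Projecting the dynamics from D to the cotangent bundle *)

Section Lift.
Variable R : realType.
Notation vec := 'cV[R]_3.
Notation mat := 'M[R]_3.
Implicit Types (q p v : vec) (h g Om A K : mat) (r s t : R).
Variables (J1 J2 : R).
Hypotheses (J1_gt0 : 0 < J1) (J2_gt0 : 0 < J2).
Local Notation J := (mass J1 J2).
Local Notation den := (den J1 J2).
Local Notation asym := (asym J1 J2).
Local Notation vel := (vel J1 J2).
Local Notation energy := (energy J1 J2).

(** The momentum as a function of the velocity; inverting this linear relation
    is what produces the explicit form of [vel]. *)
Lemma inertia_wedge q v : dot q q = 1 -> dot q v = 0 ->
  - (inertia J (wedge q v) *m q) =
  den q *: v - ((J1 - J2) * v 0 0) *: (q 0 0 *: q - basis R 0).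
Proof.
move=> q1 qv; rewrite /inertia mulmxDl -!mulmxA !wedgev.
have vJq : dot v (J *m q) = (J1 - J2) * v 0 0 * q 0 0.
  transitivity (J2 * dot q v + (J1 - J2) * v 0 0 * q 0 0).
    by rewrite !dotE !massE /=; ring.
  by rewrite qv mulr0 add0r.
have vq : dot v q = 0 by rewrite -qv !dotE; ring.
rewrite vJq vq q1 dot_mass // scale0r sub0r scale1r mulmxN.
have -> : J *m v = \col_i ((if i == 0 then J1 else J2) * v i 0).
  by apply/matrixP => i j; rewrite ord1 massE mxE.
by apply: vec3P; rewrite !mxE /den /=; ring.
Qed.

Lemma vel_momentum q v : dot q q = 1 -> dot q v = 0 ->
  vel q (- (inertia J (wedge q v) *m q)) = v.
Proof.
move=> q1 qv; have d0 := den_neq0 J1_gt0 J2_gt0 q1.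
have s0 : J1 + J2 != 0 by rewrite lt0r_neq0 // addr_gt0.
rewrite inertia_wedge // /vel; apply: (scalerI d0); rewrite scalerA divff // scale1r.
by apply: vec3P; rewrite !mxE /= /asym /den; field.
Qed.

Lemma momentum_vel q p : TS (q, p) ->
  - (inertia J (wedge q (vel q p)) *m q) = p.
Proof.
move=> qpT; have [/= q1 qp] := qpT; have d0 := den_neq0 J1_gt0 J2_gt0 q1.
have s0 : J1 + J2 != 0 by rewrite lt0r_neq0 // addr_gt0.
rewrite inertia_wedge // ?dot_vel_q // vel0 // /vel scalerA divff // scale1r.
by apply: vec3P; rewrite !mxE /= /asym; field.
Qed.

Lemma dot_body g : orthogonal g -> dot (body g 0) (body g 0) = 1.
Proof.
move=> gO; rewrite bodyT // dot_orthogonal; last exact: orthogonalT.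
by rewrite dotE !basisE /=; ring.
Qed.

(** The component of the generator v along q does not contribute to the wedge,
    so v may be taken tangent to the sphere; it is then the velocity of q. *)
Lemma D_TS g Om : D (g, Om) ->
  TS (proj J (g, Om)) /\
  Om = wedge (proj J (g, Om)).1 (vel (proj J (g, Om)).1 (proj J (g, Om)).2).
Proof.
move=> [/= gO Os [v0 OmE]]; rewrite /proj /=; set q := body g 0 in OmE *.
have q1 : dot q q = 1 by exact: dot_body.
pose v := v0 - dot q v0 *: q.
have qv : dot q v = 0.
  transitivity (dot q v0 * (1 - dot q q)); first by rewrite /v !dotE !mxE; ring.
  by rewrite q1 subrr mulr0.
have {}OmE : Om = wedge q v.
  by rewrite OmE; apply/matrixP => i j; rewrite !wedgeE /v !mxE; ring.
rewrite OmE vel_momentum //; split=> //; split=> //=.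
have vq : q 0 0 * v 0 0 + q 1 0 * v 1 0 + q 2%:R 0 * v 2%:R 0 = 0 by rewrite -dotE.
rewrite inertia_wedge //.
transitivity (den q * dot q v - (J1 - J2) * v 0 0 * (q 0 0 * (dot q q - 1))).
  by rewrite !dotE !mxE /=; ring.
by rewrite qv q1; ring.
Qed.

Lemma proj_D g q p : orthogonal g -> body g 0 = q -> TS (q, p) ->
  D (g, wedge q (vel q p)) /\ proj J (g, wedge q (vel q p)) = (q, p).
Proof.
move=> gO gq qpT; split; last by rewrite /proj /= gq momentum_vel.
by split=> //=; [exact: skew_wedge|exists (vel q p); rewrite gq].
Qed.

Lemma wedge_vel_q q p : TS (q, p) -> wedge q (vel q p) *m q = - vel q p.
Proof.
move=> qpT; have [/= q1 qp] := qpT.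
have vq : dot (vel q p) q = 0 by rewrite -(dot_vel_q J1 J2 qpT) !dotE; ring.
by rewrite wedgev vq q1 scale0r scale1r sub0r.
Qed.

Lemma wedge_vel_p q p : TS (q, p) -> wedge q (vel q p) *m p = energy q p *: q.
Proof.
by move=> qpT; rewrite wedgev dot_vel_p //; case: qpT => /= _ ->; rewrite scale0r subr0.
Qed.

Lemma is_derive_unique (V : normedModType R) (f : R -> V) t a b :
  is_derive t 1 f a -> is_derive t 1 f b -> a = b.
Proof. by move=> [_ <-] [_ <-]. Qed.

(** The multiplier disappears in the equation for p because the constraint
    form annihilates q; what remains says that both q and p are transported by the
    angular velocity. *)
Lemma D_solution_proj y : D_solution J y -> TS_solution J (fun t => proj J (y t)).
Proof.
move=> [yD [lam ysol]]; apply/TS_solutionP => // t.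
have yDt s : D ((y s).1, (y s).2) by case: (y s) (yD s).
have [qpT OmE] := D_TS (yDt t).
have {OmE} OmE : (y t).2 =
    wedge (proj J (y t)).1 (vel (proj J (y t)).1 (proj J (y t)).2).
  by move: OmE; case: (y t).
have {}qpT : TS (proj J (y t)) by move: qpT; case: (y t).
have [gd Md] := ysol t.
set q := (proj J (y t)).1 in OmE *; set p := (proj J (y t)).2 in OmE *.
set Om := (y t).2 in gd Md OmE; set g := (y t).1 in gd Md.
have gO : orthogonal g by case: (yDt t).
have qE : q = body g 0 by [].
have qpT' : TS (q, p) by rewrite /q /p -surjective_pairing.
have Oms : Om^T = - Om by case: (yDt t).
have qd : is_derive t 1 (fun s => (proj J (y s)).1) (vel q p).
  have -> : (fun s => (proj J (y s)).1) = (fun s => (y s).1^T *m basis R 0).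
    by apply/funext => s; rewrite /= bodyT //; case: (yDt s).
  have Td (i j : 'I_3) : is_derive t 1 (fun s => (y s).1^T i j) ((g *m Om)^T i j).
    under eq_fun do rewrite mxE; rewrite mxE.
    by have /is_derive_mxP := gd.
  have cd (i : 'I_3) j : is_derive t 1 (fun=> basis R 0 i j) ((0 : vec) i j).
    by rewrite [X in is_derive _ _ _ X]mxE; exact: deriv_cst.
  apply: (is_derive_eq (deriv_mulmx Td cd)).
  rewrite mulmx0 addr0 trmx_mul Oms -mulmxA -bodyT // -qE mulNmx OmE.
  by rewrite wedge_vel_q // opprK.
split=> //.
have -> : (fun s => (proj J (y s)).2) =
          (fun s => - (inertia J (y s).2 *m (proj J (y s)).1)) by [].
have /is_derive_mxP Mij := Md; have /is_derive_mxP qij := qd.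
apply: (is_derive_eq (derivN (deriv_mulmx Mij qij))).
rewrite -/q -/Om -/g; set M := inertia J Om.
have pE : M *m q = - p by rewrite /p /= opprK.
have W0 : wedge (body g 1) (body g 2%:R) *m q = 0.
  have b i : i != 0 -> dot (body g i) q = 0.
    move=> i0; rewrite qE !bodyT // dot_orthogonal; last exact: orthogonalT.
    by rewrite dot_basis basisE (negbTE i0).
  by rewrite wedgev !b // !scale0r subr0.
have qv : vel q p = - (Om *m q) by rewrite OmE wedge_vel_q // opprK.
have -> : (M *m Om - Om *m M + lam t *: wedge (body g 1) (body g 2%:R)) *m q =
    M *m (Om *m q) + Om *m p.
  by rewrite !mulmxDl -scalemxAl W0 scaler0 addr0 mulNmx -!mulmxA pE mulmxN opprK.
by rewrite qv (mulmxN M) [M *m _ + _]addrC addrK OmE wedge_vel_p // scaleNr.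
Qed.

End Lift.

(** * Lifting solutions to D by a moving frame *)

Section Frame.
Variable R : realType.
Notation vec := 'cV[R]_3.
Notation mat := 'M[R]_3.
Implicit Types (q p v : vec) (h g Om A K : mat) (r s t : R).
Variables (J1 J2 : R).
Hypotheses (J1_gt0 : 0 < J1) (J2_gt0 : 0 < J2).
Local Notation J := (mass J1 J2).
Local Notation den := (den J1 J2).
Local Notation asym := (asym J1 J2).
Local Notation vel := (vel J1 J2).
Local Notation energy := (energy J1 J2).

(** The columns are q, p and q x p, normalised; r stands for the norm of p. It
    is kept as a parameter, being constant along solutions. *)
Definition frame r q p : mat := \matrix_(i < 3, j < 3)
  [:: q i 0; r^-1 * p i 0; r^-1 * cross q p i 0]`_j.

Lemma orthogonal_frame r q p : TS (q, p) -> 0 < r -> dot p p = r ^+ 2 ->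
  orthogonal (frame r q p).
Proof.
move=> [/= q1 qp] r0 P; have {}r0 := lt0r_neq0 r0.
have cE : dot (cross q p) (cross q p) = r ^+ 2.
  transitivity (dot q q * dot p p - dot q p ^+ 2); last by rewrite q1 qp P; ring.
  by rewrite !dotE !crossE; ring.
have qc : dot q (cross q p) = 0 by rewrite !dotE !crossE; ring.
have pc : dot p (cross q p) = 0 by rewrite !dotE !crossE; ring.
have rr : r^-1 * (r^-1 * r ^+ 2) = 1 by field.
apply: mat3P; apply: ord3P; rewrite [LHS]mxE sum3E !mxE /=.
- by rewrite -dotE.
- by transitivity (r^-1 * dot q p); [rewrite dotE; ring|rewrite qp mulr0].
- transitivity (r^-1 * dot q (cross q p)); last by rewrite qc mulr0.
  by rewrite dotE !crossE; ring.
- by transitivity (r^-1 * dot q p); [rewrite dotE; ring|rewrite qp mulr0].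
- by rewrite -rr -P dotE; ring.
- transitivity (r^-1 * (r^-1 * dot p (cross q p))); last by rewrite pc !mulr0.
  by rewrite dotE !crossE; ring.
- transitivity (r^-1 * dot q (cross q p)); last by rewrite qc mulr0.
  by rewrite dotE !crossE; ring.
- transitivity (r^-1 * (r^-1 * dot p (cross q p))); last by rewrite pc !mulr0.
  by rewrite dotE !crossE; ring.
- by rewrite -rr -cE dotE !crossE; ring.
Qed.

Lemma frame_basis r q p : frame r q p *m basis R 0 = q.
Proof. by apply: vec3P; rewrite mulmxvE !basisE !mxE /=; ring. Qed.

Lemma frame_mul r q p Om : skew Om ->
  Om *m frame r q p = \matrix_(i < 3, j < 3)
    [:: (Om *m q) i 0; r^-1 * (Om *m p) i 0;
        r^-1 * (cross (Om *m q) p + cross q (Om *m p)) i 0]`_j.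
Proof.
move=> Os; rewrite -skew_cross //; apply: mat3P => i; rewrite [RHS]mxE /= mulmxvE;
  rewrite [LHS]mxE sum3E 3![frame _ _ _ _ _]mxE /=; ring.
Qed.

(** The attitude is read off from the moving frame, up to a constant element K
    of O(2) acting on the space axes. *)
Definition lift K r (x : vec * vec) : mat * mat :=
  (K *m (frame r x.1 x.2)^T, wedge x.1 (vel x.1 x.2)).

Lemma lift_proj K r x : TS x -> 0 < r -> dot x.2 x.2 = r ^+ 2 -> O2 K ->
  D (lift K r x) /\ proj J (lift K r x) = x.
Proof.
case: x => q p qpT r0 P [KO K0] /=; have FO := orthogonal_frame qpT r0 P.
have gO : orthogonal (K *m (frame r q p)^T).
  by apply: orthogonalM => //; exact: orthogonalT.
apply: proj_D => //; rewrite bodyT // trmx_mul trmxK -mulmxA.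
have -> : K^T *m basis R 0 = basis R 0 by have [_] := O2T (conj KO K0).
exact: frame_basis.
Qed.

Lemma lift_inj K K' r q p : TS (q, p) -> 0 < r -> dot p p = r ^+ 2 ->
  lift K r (q, p) = lift K' r (q, p) -> K = K'.
Proof.
move=> qpT r0 P [E]; have FO := orthogonal_frame qpT r0 P.
by rewrite -[K]mulmx1 -[K']mulmx1 -FO !mulmxA E.
Qed.

Lemma deriv_cross (u v : R -> vec) t du dv :
  is_derive t 1 u du -> is_derive t 1 v dv ->
  is_derive t 1 (fun s => cross (u s) (v s)) (cross du (v t) + cross (u t) dv).
Proof.
move=> ud vd; apply/is_derive_mxP => i j; rewrite (ord1 j) {j}.
have D k l := derivM (deriv_vec k ud) (deriv_vec l vd).
move: i; apply: ord3P; under eq_fun do rewrite crossE;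
  rewrite [X in is_derive _ _ _ X]mxE !crossE;
  by apply: (is_derive_eq (derivB (D _ _) (D _ _))); ring.
Qed.

Section Transport.
Variables (x : R -> vec * vec).
Hypothesis xsol : TS_solution J x.
Local Notation q t := ((x t).1).
Local Notation p t := ((x t).2).
Local Notation Om t := (wedge (q t) (vel (q t) (p t))).

(** The key to the reconstruction on D. Since the derivative of p is normal to
    the sphere, p is parallel along q, and so is q x p: the whole frame is
    transported by the angular velocity, exactly as the rows of g are. *)
Lemma deriv_frame r t :
  is_derive t 1 (fun s => frame r (q s) (p s)) (- (Om t *m frame r (q t) (p t))).
Proof.
have qd := sol_dq J1_gt0 J2_gt0 xsol t; have pd := sol_dp J1_gt0 J2_gt0 xsol t.
have nd := deriv_cross qd pd.
have qpT := sol_TS xsol t.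
rewrite frame_mul; last exact: skew_wedge.
rewrite wedge_vel_q // wedge_vel_p //.
have sc (f : R -> vec) i df : is_derive t 1 f df ->
    is_derive t 1 (fun s => r^-1 * f s i 0) (r^-1 * df i 0).
  move=> fd; apply: (is_derive_eq (derivM (deriv_cst r^-1 t) (deriv_vec i fd))).
  by ring.
apply/is_derive_mxP => i; apply: ord3P; under eq_fun do rewrite mxE;
  rewrite [X in is_derive _ _ _ X]mxE [X in is_derive _ _ _ (- X)]mxE /=.
- by apply: (is_derive_eq (deriv_vec i qd)); rewrite [in RHS]mxE opprK.
- by apply: (is_derive_eq (sc _ i _ pd)); rewrite !mxE; ring.
- apply: (is_derive_eq (sc _ i _ nd)).
  move: (vel _ _) (energy _ _) => v e.
  by move: i; apply: ord3P; rewrite !mxE /=; ring.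
Qed.

Lemma deriv_lift_attitude K r t :
  is_derive t 1 (fun s => K *m (frame r (q s) (p s))^T)
                (K *m (frame r (q t) (p t))^T *m Om t).
Proof.
have /is_derive_mxP Fd := deriv_frame r t.
have Kd (i j : 'I_3) : is_derive t 1 (fun=> K i j) ((0 : mat) i j).
  by rewrite [X in is_derive _ _ _ X]mxE; exact: deriv_cst.
have Td (i j : 'I_3) : is_derive t 1 (fun s => (frame r (q s) (p s))^T i j)
    ((- (Om t *m frame r (q t) (p t)))^T i j).
  by under eq_fun do rewrite mxE; rewrite [X in is_derive _ _ _ X]mxE.
apply: (is_derive_eq (deriv_mulmx Kd Td)); rewrite mul0mx add0r.
have Os : (Om t)^T = - Om t by exact: skew_wedge.
by rewrite linearN /= trmx_mul Os !mulmxN opprK mulmxA.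
Qed.

Lemma derivable_vel t : exists dv, is_derive t 1 (fun s => vel (q s) (p s)) dv.
Proof.
have qd i := deriv_vec i (sol_dq J1_gt0 J2_gt0 xsol t).
have pd i := deriv_vec i (sol_dp J1_gt0 J2_gt0 xsol t).
suff D i : derivable (fun s => vel (q s) (p s) i 0) t 1.
  exists ('D_1 (fun s => vel (q s) (p s)) t); apply: derivableP.
  by apply/derivable_mxP => i j; rewrite (ord1 j).
have -> : (fun s => vel (q s) (p s) i 0) = (fun s => (den (q s))^-1 *
    (p s i 0 + (asym * p s 0 0) * (q s 0 0 * q s i 0 - basis R 0 i 0))).
  by apply/funext => s; rewrite !mxE.
have := derivM (sol_dden_inv J1_gt0 J2_gt0 xsol t) (derivD (pd i)
  (derivM (derivM (deriv_cst asym t) (pd 0)) (derivB (derivM (qd 0) (qd i))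
     (deriv_cst (basis R 0 i 0) t)))).
by case.
Qed.

Lemma deriv_momentum t : exists2 dM, skew dM &
  is_derive t 1 (fun s => inertia J (Om s)) dM.
Proof.
have [dv vd] := derivable_vel t; have qd := sol_dq J1_gt0 J2_gt0 xsol t.
pose dOm := wedge (vel (q t) (p t)) (vel (q t) (p t)) + wedge (q t) dv.
have Od : forall i j : 'I_3, is_derive t 1 (fun s => Om s i j) (dOm i j).
  move=> i j; under eq_fun do rewrite wedgeE; rewrite /dOm mxE !wedgeE.
  apply: (is_derive_eq (derivB (derivM (deriv_vec i qd) (deriv_vec j vd))
                               (derivM (deriv_vec i vd) (deriv_vec j qd)))).
  by ring.
have Jd (i j : 'I_3) : is_derive t 1 (fun=> J i j) ((0 : mat) i j).
  by rewrite [X in is_derive _ _ _ X]mxE; exact: deriv_cst.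
exists (inertia J dOm); last first.
  apply: (is_derive_eq (derivD (deriv_mulmx Jd Od) (deriv_mulmx Od Jd))).
  by rewrite mul0mx add0r mulmx0 addr0.
have JT : J^T = J by rewrite /mass tr_diag_mx.
have Os : dOm^T = - dOm.
  by rewrite linearD /= opprD; congr (_ + _); exact: skew_wedge.
by rewrite /skew /= /inertia linearD /= !trmx_mul JT Os mulmxN mulNmx opprD addrC.
Qed.

(** Differentiating the relation between momentum and velocity shows that the
    defect of the unconstrained equation annihilates q; being skew, it is a
    multiple of the constraint form, and the factor is the multiplier. *)
Lemma D_solution_lift K r : O2 K -> 0 < r -> dot (p 0) (p 0) = r ^+ 2 ->
  D_solution J (fun t => lift K r (x t)).
Proof.
move=> KO r0 P0; have P t : dot (p t) (p t) = r ^+ 2.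
  by rewrite -P0; exact: (sol_normp J1_gt0 J2_gt0 xsol t 0).
have xT t : TS (x t) by case: (xsol t).
have L t := lift_proj (xT t) r0 (P t) KO.
split=> [t|]; first by case: (L t).
suff E t : exists l, is_derive t 1 (fun s => inertia J (Om s))
   (inertia J (Om t) *m Om t - Om t *m inertia J (Om t) +
    l *: wedge (body (lift K r (x t)).1 1) (body (lift K r (x t)).1 2%:R)).
  have [lam lamE] := choice E; exists lam => t; split; last exact: lamE.
  exact: deriv_lift_attitude.
have [dM Ms Md] := deriv_momentum t.
have [[gO _ _] pr] := L t.
have gq : body (lift K r (x t)).1 0 = q t by have := congr1 fst pr.
set M := inertia J (Om t).
have Ot : (Om t)^T = - Om t by exact: skew_wedge.
have JT : J^T = J by rewrite /mass tr_diag_mx.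
have MT : M^T = - M.
  by rewrite /M /inertia linearD /= !trmx_mul JT Ot mulmxN mulNmx opprD addrC.
have [] := @skew_ker_wedge _ (lift K r (x t)).1 (dM - (M *m Om t - Om t *m M)) gO.
- have dMT : dM^T = - dM by exact: Ms.
  rewrite /skew /= linearB /= dMT linearB /= !trmx_mul Ot MT.
  by rewrite !mulmxN !mulNmx !opprK [in RHS]opprB addrC [in LHS]opprB.
- have /is_derive_mxP qd := sol_dq J1_gt0 J2_gt0 xsol t.
  have /is_derive_mxP Mij := Md.
  have pd := sol_dp J1_gt0 J2_gt0 xsol t.
  have pE s : - (inertia J (Om s) *m q s) = p s.
    by apply: momentum_vel => //; exact: (sol_TS xsol s).
  have := derivN (deriv_mulmx Mij qd).
  under eq_fun do rewrite pE.
  move=> /is_derive_unique /(_ pd); rewrite -/M scaleNr => /oppr_inj E.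
  have qpT := sol_TS xsol t; have Mq : M *m q t = - p t by rewrite -(pE t) opprK.
  rewrite gq mulmxBl (mulmxBl (M *m _)) -(mulmxA M) -(mulmxA (Om t)) Mq.
  rewrite wedge_vel_q // (mulmxN M) (mulmxN (Om t)) wedge_vel_p // -E.
  by rewrite opprK [dM *m _ + _]addrC addKr subrr.
by move=> l lE; exists l; rewrite -lE addrC subrK.
Qed.

End Transport.

End Frame.

(** * Quasi-periodicity on D *)

Section Reconstruction.
Variable R : realType.
Notation vec := 'cV[R]_3.
Notation mat := 'M[R]_3.
Implicit Types (q p v : vec) (h g Om A K : mat) (r s t : R).
Variables (J1 J2 : R).
Hypotheses (J1_gt0 : 0 < J1) (J2_gt0 : 0 < J2).
Local Notation J := (mass J1 J2).
Local Notation den := (den J1 J2).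
Local Notation asym := (asym J1 J2).
Local Notation vel := (vel J1 J2).
Local Notation energy := (energy J1 J2).
Local Notation lift := (lift J1 J2).

Lemma D_sol_TS y : D_solution J y -> forall t, TS (proj J (y t)) /\
  (y t).2 = wedge (proj J (y t)).1 (vel (proj J (y t)).1 (proj J (y t)).2).
Proof.
by move=> [yD _] t; have := yD t; case: (y t) => g Om /(D_TS J1_gt0 J2_gt0).
Qed.

(** The transpose of the attitude g and the frame obey the same transport
    equation, so the product of g with the frame is constant. Hence solutions on D carry no more
    dynamical information than their projections. *)
Lemma D_solution_is_lift y r : D_solution J y -> 0 < r ->
  dot (proj J (y 0)).2 (proj J (y 0)).2 = r ^+ 2 ->
  exists2 K, O2 K & forall t, y t = lift K r (proj J (y t)).
Proof.
move=> ysol r0 P0; have xsol := D_solution_proj J1_gt0 J2_gt0 ysol.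
have P t : dot (proj J (y t)).2 (proj J (y t)).2 = r ^+ 2.
  by rewrite -P0; exact: (sol_normp J1_gt0 J2_gt0 xsol t 0).
have FO t : orthogonal (frame r (proj J (y t)).1 (proj J (y t)).2).
  by apply: orthogonal_frame => //; exact: (sol_TS xsol).
have [yD [lam ydyn]] := ysol.
have gO t : orthogonal (y t).1 by case: (yD t).
pose K t := (y t).1 *m frame r (proj J (y t)).1 (proj J (y t)).2.
have KE t : K t = K 0.
  apply: deriv_cst_eq => {}t; have [gd _] := ydyn t.
  have /is_derive_mxP gij := gd.
  have /is_derive_mxP Fij := deriv_frame J1_gt0 J2_gt0 xsol r t.
  apply: (is_derive_eq (deriv_mulmx gij Fij)).
  have [_ <-] := D_sol_TS ysol t.
  by rewrite mulmxN mulmxA subrr.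
exists (K 0).
  split; first by apply: orthogonalM.
  rewrite /K -mulmxA frame_basis /= bodyT // mulmxA orthogonal_mulmxT //.
  exact: mul1mx.
move=> t; rewrite [LHS]surjective_pairing; have [_ ->] := D_sol_TS ysol t.
by congr (_, _); rewrite -(KE t) /K -mulmxA orthogonal_mulmxT // mulmx1.
Qed.

Lemma lift_continuous (T : topologicalType) K r (f : T -> vec * vec) :
  continuous f -> (forall a, TS (f a)) -> continuous (fun a => lift K r (f a)).
Proof.
move=> fc fT.
have c1 i : continuous (fun a => (f a).1 i 0).
  apply: (cont_comp (@coord_continuous _ _ _ i 0)) => a.
  by apply: (cvg_comp _ _ (fc a)); exact: cvg_fst.
have c2 i : continuous (fun a => (f a).2 i 0).
  apply: (cont_comp (@coord_continuous _ _ _ i 0)) => a.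
  by apply: (cvg_comp _ _ (fc a)); exact: cvg_snd.
have cc := @cont_cst R T.
have dc : continuous (fun a => (den (f a).1)^-1).
  apply: contV => [a|]; first by apply: den_neq0 => //; case: (fT a).
  rewrite /den; under eq_fun do rewrite expr2.
  by apply: contD; [exact: cc|apply: contM; [exact: cc|exact: contM]].
have vc i : continuous (fun a => vel (f a).1 (f a).2 i 0).
  have -> : (fun a => vel (f a).1 (f a).2 i 0) = (fun a => (den (f a).1)^-1 *
    ((f a).2 i 0 + (asym * (f a).2 0 0) * ((f a).1 0 0 * (f a).1 i 0 - basis R 0 i 0))).
    by apply/funext => s; rewrite !mxE.
  apply: contM => //; apply: contD => //; apply: contM; first exact: contM.
  by apply: contB => //; exact: contM.
have Fc i j : continuous (fun a => frame r (f a).1 (f a).2 i j).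
  move: j; apply: ord3P; under eq_fun do rewrite mxE /=; first exact: c1.
    by apply: contM.
  apply: contM => //; move: i; apply: ord3P; under eq_fun do rewrite crossE;
  by apply: contB; exact: contM.
apply: cont_pair; apply: continuous_mxP => i j.
  pose F k a := K i k * frame r (f a).1 (f a).2 j k.
  have Fkc k : continuous (F k) by apply: contM; [exact: cc|exact: Fc].
  have -> : (fun a => (K *m (frame r (f a).1 (f a).2)^T) i j) =
            (fun a => F 0 a + F 1 a + F 2%:R a).
    by apply/funext => a; rewrite mxE sum3E /F ![_^T _ _]mxE.
  by apply: contD => //; exact: contD.
under eq_fun do rewrite wedgeE.
by apply: contB; exact: contM.
Qed.

(** The lift with a fixed K is an embedding with left inverse [proj], so it
    carries the invariant torus and its linear flow to D. Comparing initial values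
    shows that every solution starting on the lifted torus has this same K. *)
Lemma D_quasi_periodic y : D_solution J y ->
  cross (proj J (y 0)).1 (proj J (y 0)).2 0 0 != 0 ->
  ((proj J (y 0)).1 0 0, (proj J (y 0)).2 0 0) <> (0, 0) ->
  quasi_periodic (D_solution J) y.
Proof.
move=> ysol L0 qp0; have xsol := D_solution_proj J1_gt0 J2_gt0 ysol.
have [phi [w [phic phiI phiF phiR phiP]]] := invariant_torus J1_gt0 J2_gt0 xsol L0 qp0.
have P0 := oriented_normp_gt0 (sol_TS xsol 0) L0.
pose r := Num.sqrt (dot (proj J (y 0)).2 (proj J (y 0)).2).
have r0 : 0 < r by rewrite sqrtr_gt0.
have rE : dot (proj J (y 0)).2 (proj J (y 0)).2 = r ^+ 2 by rewrite sqr_sqrtr // ltW.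
have [K KO yE] := D_solution_is_lift ysol r0 rE.
pose z a t := phi (a.1 + t * w.1, a.2 + t * w.2).
have zsol a : TS_solution J (z a) /\ z a 0 = phi a by apply/phiF.
have phiT a : TS (phi a) by have [zs <-] := zsol a; case: (zs 0).
have Lp a : proj J (lift K r (phi a)) = phi a.
  by have [] := lift_proj J1_gt0 J2_gt0 (phiT a) r0 (etrans (phiP a) rE) KO.
exists (fun a => lift K r (phi a)), w; split.
- exact: lift_continuous.
- move=> a b; rewrite -phiI; split=> [E|-> //].
  by rewrite -(Lp a) E Lp.
- move=> a u; split=> [[usol u0] t|uE].
    have pu : TS_solution J (fun t => proj J (u t)) /\ proj J (u 0) = phi a.
      by split; [exact: D_solution_proj|rewrite u0 Lp].
    have uP : dot (proj J (u 0)).2 (proj J (u 0)).2 = r ^+ 2.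
      by rewrite pu.2 phiP.
    have [K' KO' uE] := D_solution_is_lift usol r0 uP.
    have /phiF puE := pu.
    rewrite uE puE; congr lift.
    have := uE 0; rewrite u0 Lp => /esym.
    have := phiT a; have := phiP a; case: (phi a) => q p /= pP pT.
    by apply: (lift_inj pT r0); rewrite pP.
  have [zs z0] := zsol a.
  have -> : u = (fun t => lift K r (z a t)) by apply/funext.
  split; last by rewrite z0.
  by apply: D_solution_lift => //; rewrite z0 phiP.
- move=> _ [t _ <-]; rewrite yE.
  have [a _ aE] : range phi (proj J (y t)) by apply: phiR; exists t.
  by exists a; rewrite ?aE.
Qed.

End Reconstruction.

(** * Steady rotations and equilibria *)

Section Steady.
Variable R : realType.
Notation vec := 'cV[R]_3.
Notation mat := 'M[R]_3.
Implicit Types (q p u v : vec) (h g Om A K : mat) (r s t : R).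
Variables (J1 J2 : R).
Hypotheses (J1_gt0 : 0 < J1) (J2_gt0 : 0 < J2).
Local Notation J := (mass J1 J2).
Local Notation den := (den J1 J2).
Local Notation asym := (asym J1 J2).
Local Notation vel := (vel J1 J2).
Local Notation energy := (energy J1 J2).
Local Notation lift := (lift J1 J2).

(** Completeness of the moving frame. *)
Lemma frame_expansion q p u : TS (q, p) -> 0 < dot p p ->
  u = dot q u *: q + (dot p u / dot p p) *: p
      + (dot (cross q p) u / dot p p) *: cross q p.
Proof.
move=> qpT P0; pose r := Num.sqrt (dot p p).
have r0 : 0 < r by rewrite sqrtr_gt0.
have rE : dot p p = r ^+ 2 by rewrite sqr_sqrtr // ltW.
have FO := orthogonal_frame qpT r0 rE.
rewrite -[LHS]mul1mx -(orthogonal_mulmxT FO) -mulmxA rE.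
have FT j : ((frame r q p)^T *m u) j 0 =
    [:: dot q u; r^-1 * dot p u; r^-1 * dot (cross q p) u]`_j.
  rewrite mulmxvE ![_^T _ _]mxE; move: j; apply: ord3P;
  by rewrite ![frame _ _ _ _ _]mxE /= !dotE; ring.
have Fij i j : frame r q p i j = [:: q i 0; r^-1 * p i 0; r^-1 * cross q p i 0]`_j.
  by rewrite mxE.
have r1 := lt0r_neq0 r0; move: (cross q p) Fij FT => c Fij FT.
by apply: vec3P; rewrite mulmxvE !FT !Fij /= !mxE; field.
Qed.

Lemma mem_span2 u v w : w \in <<[:: u; v]>>%VS -> exists a b : R, w = a *: u + b *: v.
Proof.
rewrite span_cons span_seq1 => /memv_addP[_ /vlineP[a ->] [_ /vlineP[b ->] ->]].
by exists a, b.
Qed.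

Lemma span_qp q p u : TS (q, p) -> 0 < dot p p ->
  (u \in <<[:: q; p]>>%VS) = (dot (cross q p) u == 0).
Proof.
move=> qpT P0; apply/idP/eqP => [/mem_span2[a [b ->]]|n0].
  by rewrite !dotE !crossE !mxE; ring.
rewrite (frame_expansion u qpT P0) n0 mul0r scale0r addr0.
by apply: rpredD; apply: rpredZ; apply: memv_span; rewrite !inE eqxx ?orbT.
Qed.

Lemma wedge_qp_neq0 q p : TS (q, p) -> 0 < dot p p -> wedge q p != 0.
Proof.
move=> [/= q1 qp] P0; apply/eqP => W0.
have : dot q (wedge q p *m p) = dot p p.
  rewrite wedgev qp scale0r subr0.
  transitivity (dot p p * dot q q); last by rewrite q1 mulr1.
  by rewrite !dotE !mxE; ring.
by rewrite W0 mul0mx dotE !mxE !mulr0 !addr0 => /esym/eqP; rewrite gt_eqF.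
Qed.

Lemma free_qp q p : TS (q, p) -> 0 < dot p p -> free [:: q; p].
Proof.
move=> qpT P0; rewrite free_cons span_seq1 seq1_free; apply/andP; split; last first.
  by apply: contraTneq P0 => ->; rewrite dotE !mxE !mulr0 !addr0 ltxx.
apply/negP => /vlineP[k qE]; have [/= q1 qp] := qpT.
have : k * dot p p = 0 by rewrite -qp qE !dotE !mxE; ring.
move/eqP; rewrite mulf_eq0 [dot p p == 0]gt_eqF // orbF => /eqP k0.
move: q1; rewrite qE k0 scale0r dotE !mxE !mulr0 !addr0 => /eqP.
by rewrite eq_sym oner_eq0.
Qed.

Lemma rotation_in_qp q p c : TS (q, p) -> 0 < dot p p -> c != 0 ->
  (cross q p 0 0 = 0 \/ q 0 0 = 0 /\ p 0 0 = 0) ->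
  rotation_in J <<[:: q; p]>>%VS (c *: wedge q p).
Proof.
move=> qpT P0 c0 ax; split.
- by have := free_qp qpT P0; rewrite /free => /eqP.
- move=> u; rewrite !span_qp // => /eqP nu.
  have -> : dot (cross q p) (J *m u) =
      J2 * dot (cross q p) u + (J1 - J2) * (cross q p 0 0 * u 0 0).
    by rewrite !dotE !massE /=; ring.
  rewrite nu mulr0 add0r mulf_eq0; apply/orP; right; apply/eqP.
  case: ax => [->|[q0 p0]]; first by rewrite mul0r.
  by move: nu; rewrite dotE !crossE q0 p0; lra.
- by rewrite scaler_eq0 negb_or c0 wedge_qp_neq0.
- by exists q, p, c.
Qed.

Lemma axial_qp q p : TS (q, p) -> 0 < dot p p -> cross q p 0 0 = 0 ->
  axial <<[:: q; p]>>%VS.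
Proof.
move=> qpT P0 n0; rewrite /axial span_qp //.
by rewrite dotE !basisE n0 /= mul0r !mulr0 !addr0.
Qed.

Lemma equatorial_qp q p : TS (q, p) -> 0 < dot p p -> q 0 0 = 0 -> p 0 0 = 0 ->
  cross q p 0 0 != 0 -> equatorial <<[:: q; p]>>%VS.
Proof.
move=> qpT P0 q0 p0 n0 u; rewrite span_qp // dot_basis.
have -> : dot (cross q p) u = cross q p 0 0 * u 0 0.
  by rewrite dotE !crossE q0 p0; ring.
by rewrite mulf_eq0 (negbTE n0).
Qed.

(** The velocity lies in the orthogonal complement of q. In both cases
    it also lies in the span of q and p: either that plane contains the symmetry
    axis and is preserved by the inertia, or q and p are equatorial and the
    inertia acts as a scalar. *)
Lemma vel_parallel q p : TS (q, p) -> 0 < dot p p ->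
  (cross q p 0 0 = 0 \/ q 0 0 = 0 /\ p 0 0 = 0) ->
  vel q p = (energy q p / dot p p) *: p.
Proof.
move=> qpT P0 ax; have [/= q1 qp] := qpT.
have d0 := den_neq0 J1_gt0 J2_gt0 q1; have P1 := lt0r_neq0 P0.
rewrite /vel /energy; case: ax => [n0|[q0 p0]]; last first.
  by rewrite p0 mulr0 scale0r addr0 expr0n mulr0 subr0 mulfK.
have -> : q 0 0 *: q - basis R 0 = - (p 0 0 / dot p p) *: p.
  rewrite [X in _ - X](frame_expansion _ qpT P0).
  have E v : dot v (basis R 0) = v 0 0 by rewrite dotE !basisE /=; ring.
  by rewrite !E n0 mul0r scale0r addr0 opprD addrA subrr add0r scaleNr.
move: (dot p p) P1 => P P1.
by apply: vec3P; rewrite !mxE; field; rewrite ?d0 ?P1.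
Qed.

Section SteadySolution.
Variables (x : R -> vec * vec).
Hypothesis xsol : TS_solution J x.
Hypothesis P_gt0 : 0 < dot (x 0).2 (x 0).2.
Local Notation q t := ((x t).1).
Local Notation p t := ((x t).2).

(** The velocity being parallel to p, and the force parallel to q, the
    bivector of q and p is constant. *)
Lemma steady_spin k : (forall t, vel (q t) (p t) = k *: p t) -> forall t,
  wedge (q t) (vel (q t) (p t)) = k *: wedge (q 0) (p 0).
Proof.
move=> vE t; rewrite vE.
have -> : wedge (q t) (k *: p t) = k *: wedge (q t) (p t).
  by apply/matrixP => i j; rewrite [RHS]mxE !wedgeE !mxE; ring.
congr (_ *: _); apply: (@deriv_cst_eq _ _ _ (fun t => wedge (q t) (p t))) => {}t.
apply/is_derive_mxP => i j; under eq_fun do rewrite wedgeE.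
have qd := sol_dq J1_gt0 J2_gt0 xsol t; have pd := sol_dp J1_gt0 J2_gt0 xsol t.
apply: (is_derive_eq (derivB (derivM (deriv_vec i qd) (deriv_vec j pd))
                             (derivM (deriv_vec i pd) (deriv_vec j qd)))).
by rewrite vE !mxE; ring.
Qed.

(** Both conditions persist: the first by the Wronskian, the second
    because the axial oscillator is at rest. *)
Lemma sol_planes :
  (cross (q 0) (p 0) 0 0 = 0 \/ q 0 0 0 = 0 /\ p 0 0 0 = 0) ->
  forall t, cross (q t) (p t) 0 0 = 0 \/ q t 0 0 = 0 /\ p t 0 0 = 0.
Proof.
move=> [L0|[q0 p0]] t; [left|right].
  by apply/eqP; rewrite (sol_cross_eq0 J1_gt0 J2_gt0 xsol t 0) L0.
have [] := sol_axial J1_gt0 J2_gt0 xsol P_gt0 t.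
rewrite q0 p0 !mul0r subr0 addr0 => -> /eqP; rewrite mulf_eq0 invr_eq0 mulf_eq0.
rewrite [J1 + J2 == 0]gt_eqF ?addr_gt0 // [freq _ _ _ _ == 0]gt_eqF ?sol_freq_gt0 //.
by rewrite !orbF => /eqP.
Qed.

Lemma sol_steady :
  (cross (q 0) (p 0) 0 0 = 0 \/ q 0 0 0 = 0 /\ p 0 0 0 = 0) ->
  exists2 c, c != 0 &
    forall t, wedge (q t) (vel (q t) (p t)) = c *: wedge (q 0) (p 0).
Proof.
move=> pl; exists (energy (q 0) (p 0) / dot (p 0) (p 0)).
  by rewrite lt0r_neq0 // divr_gt0 // energy_gt0 //; exact: (sol_TS xsol 0).
apply: steady_spin => t; rewrite vel_parallel //.
- by rewrite (sol_energy J1_gt0 J2_gt0 xsol t 0) (sol_normp J1_gt0 J2_gt0 xsol t 0).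
- exact: (sol_TS xsol t).
- by rewrite (sol_normp J1_gt0 J2_gt0 xsol t 0).
- exact: sol_planes.
Qed.

End SteadySolution.

Lemma TS_steady (plane : {vspace vec} -> Prop) x : TS_solution J x ->
  0 < dot (x 0).2 (x 0).2 ->
  (cross (x 0).1 (x 0).2 0 0 = 0 \/ (x 0).1 0 0 = 0 /\ (x 0).2 0 0 = 0) ->
  plane <<[:: (x 0%R).1; (x 0%R).2]>>%VS -> TS_steady_rotation J plane x.
Proof.
move=> xsol P0 ax pl; have [c c0 cE] := sol_steady xsol P0 ax.
exists <<[:: (x 0%R).1; (x 0%R).2]>>%VS, (c *: wedge (x 0).1 (x 0).2); split=> //.
  by apply: rotation_in_qp => //; exact: (sol_TS xsol 0).
move=> t; pose r := Num.sqrt (dot (x 0).2 (x 0).2).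
have r0 : 0 < r by rewrite sqrtr_gt0.
have rE : dot (x t).2 (x t).2 = r ^+ 2.
  by rewrite (sol_normp J1_gt0 J2_gt0 xsol t 0) sqr_sqrtr // ltW.
have xT : TS (x t) by case: (xsol t).
have := lift_proj J1_gt0 J2_gt0 xT r0 rE (O2_1 R); rewrite /lift cE => -[Dl pE].
by exists (1%:M *m (frame r (x t).1 (x t).2)^T).
Qed.

Lemma D_steady (plane : {vspace vec} -> Prop) y : D_solution J y ->
  let x t := proj J (y t) in
  0 < dot (x 0).2 (x 0).2 ->
  (cross (x 0).1 (x 0).2 0 0 = 0 \/ (x 0).1 0 0 = 0 /\ (x 0).2 0 0 = 0) ->
  plane <<[:: (x 0%R).1; (x 0%R).2]>>%VS -> D_steady_rotation J plane y.
Proof.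
move=> ysol x P0 ax pl; have xsol := D_solution_proj J1_gt0 J2_gt0 ysol.
have [c c0 cE] := sol_steady xsol P0 ax.
exists <<[:: (x 0%R).1; (x 0%R).2]>>%VS, (c *: wedge (x 0).1 (x 0).2); split=> //.
  by apply: rotation_in_qp => //; exact: (sol_TS xsol 0).
by move=> t; have [_ ->] := D_sol_TS J1_gt0 J2_gt0 ysol t; exact: cE.
Qed.

Lemma dot_eq0 p : dot p p = 0 -> p = 0.
Proof.
rewrite dotE -!expr2 => /eqP; rewrite paddr_eq0 ?addr_ge0 ?sqr_ge0 //.
rewrite paddr_eq0 ?sqr_ge0 // !sqrf_eq0 => /andP[/andP[/eqP ? /eqP ?] /eqP ?].
by apply: vec3P; rewrite mxE.
Qed.

Lemma vel_0 q : vel q 0 = 0.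
Proof. by rewrite /vel mxE mulr0 scale0r addr0 scaler0. Qed.

Lemma TS_equilibrium x : TS_solution J x -> dot (x 0).2 (x 0).2 = 0 ->
  equilibrium x.
Proof.
move=> xsol P0 t.
have p0 s : (x s).2 = 0.
  by apply: dot_eq0; rewrite (sol_normp J1_gt0 J2_gt0 xsol s 0).
rewrite [LHS]surjective_pairing [RHS]surjective_pairing !p0; congr (_, _).
apply: (@deriv_cst_eq _ _ _ (fun t => (x t).1)) => s.
by have := sol_dq J1_gt0 J2_gt0 xsol s; rewrite p0 vel_0.
Qed.

Lemma wedge_0 q : wedge q 0 = 0.
Proof. by rewrite /wedge trmx0 mulmx0 mul0mx subr0. Qed.

(** Without momentum the angular velocity vanishes, so the attitude is
    constant too. *)
Lemma D_equilibrium y : D_solution J y ->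
  dot (proj J (y 0)).2 (proj J (y 0)).2 = 0 -> equilibrium y.
Proof.
move=> ysol P0 t; have xsol := D_solution_proj J1_gt0 J2_gt0 ysol.
have Om0 s : (y s).2 = 0.
  have [_ ->] := D_sol_TS J1_gt0 J2_gt0 ysol s.
  have -> : (proj J (y s)).2 = 0.
    by apply: dot_eq0; rewrite (sol_normp J1_gt0 J2_gt0 xsol s 0).
  by rewrite vel_0 wedge_0.
rewrite [LHS]surjective_pairing [RHS]surjective_pairing !Om0; congr (_, _).
have [_ [lam ydyn]] := ysol.
apply: (@deriv_cst_eq _ _ _ (fun t => (y t).1)) => s.
by have [] := ydyn s; rewrite Om0 mulmx0.
Qed.

Lemma D_solution_cst y0 : D y0 -> (proj J y0).2 = 0 -> D_solution J (fun=> y0).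
Proof.
move=> Dy p0; have [_ OmE] : TS (proj J y0) /\
    y0.2 = wedge (proj J y0).1 (vel (proj J y0).1 (proj J y0).2).
  by case: y0 Dy {p0} => g Om /(D_TS J1_gt0 J2_gt0).
have {}OmE : y0.2 = 0 by rewrite OmE p0 vel_0 wedge_0.
split=> //; exists (fun=> 0) => t; rewrite /= OmE !mulmx0 mul0mx subr0 scale0r addr0.
by split; exact: deriv_cst.
Qed.

End Steady.

(** * Strata in terms of reduced coordinates *)

Section Strata.
Variable R : realType.
Notation vec := 'cV[R]_3.
Implicit Types (q p u v : vec).

Lemma planar_E u : planar u 0 0 = u 1 0 /\ planar u 1 0 = u 2%:R 0.
Proof. by split; rewrite mxE; congr (u _ _); apply: val_inj. Qed.

Lemma free_plane (a b : 'cV[R]_2) :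
  free [:: a; b] = (a 0 0 * b 1 0 - a 1 0 * b 0 0 != 0).
Proof.
have ext (u v : 'cV[R]_2) : u 0 0 = v 0 0 -> u 1 0 = v 1 0 -> u = v.
  move=> u0 u1; apply/matrixP => i j; rewrite (ord1 j).
  case: i => [[|[|//]] i2]; [rewrite (_ : Ordinal _ = 0)|
                             rewrite (_ : Ordinal _ = 1)];
  by rewrite //; apply: val_inj.
rewrite free_cons span_seq1 seq1_free -negb_or; congr (~~ _).
apply/idP/eqP => [/orP[/vlineP[k ->]|/eqP ->]|ab].
- by rewrite !mxE; ring.
- by rewrite !mxE; ring.
have [->|b0] := eqVneq b 0; first by rewrite orbT.
rewrite orbF; apply/vlineP.
have [b00|b00] := eqVneq (b 0 0) 0.
  have b10 : b 1 0 != 0.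
    by apply: contraNneq b0 => b10; apply/eqP; apply: ext; rewrite mxE.
  exists (a 1 0 / b 1 0); apply: ext; rewrite !mxE; last by field.
  move: ab; rewrite b00 !mulr0 subr0 => /eqP.
  by rewrite mulf_eq0 (negbTE b10) orbF => /eqP.
exists (a 0 0 / b 0 0); apply: ext; rewrite !mxE; first by field.
by apply: (mulIf b00); rewrite mulrAC divfK //; apply/eqP; rewrite eq_sym -subr_eq0 ab.
Qed.

Lemma free_planar q p : free [:: planar q; planar p] = (cross q p 0 0 != 0).
Proof.
have [q0 q1] := planar_E q; have [p0 p1] := planar_E p.
by rewrite free_plane cross0E q0 q1 p0 p1.
Qed.

Lemma cross_act_eq0 (h : 'M[R]_3) (x : vec * vec) : O2 h -> TS x ->
  (cross (act h x).1 (act h x).2 0 0 == 0) = (cross x.1 x.2 0 0 == 0).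
Proof.
move=> hO; case: x => q p qpT; have hT := TS_act hO qpT.
rewrite -sqrf_eq0 -[RHS]sqrf_eq0 gram_axial // gram_axial //.
by have [_ _] := coords_act (q, p) hO => /=; rewrite /= !O2_axial // => ->.
Qed.

Lemma S3P (x : vec * vec) : TS x -> S3 (O2_orbit x) <-> cross x.1 x.2 0 0 != 0.
Proof.
move=> xT; split=> [[z [zT zfree] /orbit_eq[h hO zE]]|L0].
  by move: zfree; rewrite free_planar zE cross_act_eq0.
by exists x => //; split=> //; rewrite free_planar.
Qed.

Lemma S2_cross (x : vec * vec) : TS x -> S2 (O2_orbit x) -> cross x.1 x.2 0 0 = 0.
Proof.
move=> xT [z [zT + _] /orbit_eq[h hO zE]].
by rewrite free_planar negbK zE cross_act_eq0 // => /eqP.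
Qed.

(** If both planar parts vanished, q would be on the axis and p, orthogonal to
    q, would vanish. *)
Lemma cross_S2 (x : vec * vec) : TS x -> cross x.1 x.2 0 0 = 0 ->
  0 < dot x.2 x.2 -> S2 (O2_orbit x).
Proof.
case: x => q p qpT /= L0 P0; exists (q, p) => //; split=> //=.
  by rewrite free_planar L0 eqxx.
apply: contraTneq P0 => -[/matrixP qE /matrixP pE].
have [q1 q2] := planar_E q; have [p1 p2] := planar_E p.
have := qE 0 0; have := qE 1 0; have := pE 0 0; have := pE 1 0.
rewrite q1 q2 p1 p2 !mxE => p20 p10 q20 q10.
have [/= qq qp] := qpT; move: qq qp; rewrite !dotE q10 q20 p10 p20 !mulr0 !addr0.
move=> qq qp; have q0 : q 0 0 != 0.
  by apply: contra_eq_neq qq => ->; rewrite mul0r eq_sym oner_eq0.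
by move/eqP: qp; rewrite mulf_eq0 (negbTE q0) => /= /eqP ->; rewrite mul0r ltxx.
Qed.

End Strata.

(** * The reconstruction theorem *)

Section Reconstructions.
Variable R : realType.
Notation vec := 'cV[R]_3.
Notation mat := 'M[R]_3.
Variables (J1 J2 : R).
Hypotheses (J1_gt0 : 0 < J1) (J2_gt0 : 0 < J2).
Local Notation J := (mass J1 J2).
Variable gam : R -> set (vec * vec).
Hypothesis gamP : reduced_solution J gam.

Lemma D_TS_reconstruction y : D_reconstruction J gam y ->
  TS_reconstruction J gam (fun t => proj J (y t)).
Proof. by move=> [ysol yE]; split=> //; exact: D_solution_proj. Qed.

(** On the cotangent bundle a point of the fibre is obtained from the given
    solution by a symmetry. On D the lift is started with the K fitted to the
    given attitude; when p vanishes there is no frame, but then the point of D is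
    at rest. *)
Lemma reconstructible_gam : reconstructible J gam.
Proof.
have [x xsol gamE] := gamP.
have TSrec x0 : O2_orbit x0 = gam 0 -> exists2 z, TS_reconstruction J gam z & z 0 = x0.
  rewrite gamE => /orbit_eq[h hO x0E]; exists (fun t => act h (x t)) => //.
  split; first exact: TS_solution_act.
  by move=> t; rewrite orbit_act.
split=> // y0 Dy /TSrec[z [zsol zE] z0].
have zT t : TS (z t) by case: (zsol t).
have [P0|P0] := eqVneq (dot (z 0).2 (z 0).2) 0.
  have p0 := dot_eq0 P0; rewrite z0 in p0.
  exists (fun=> y0) => //; split; first exact: D_solution_cst.
  by move=> t; rewrite -zE (TS_equilibrium J1_gt0 J2_gt0 zsol P0 t) z0.
have {}P0 : 0 < dot (z 0).2 (z 0).2.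
  by rewrite lt_neqAle eq_sym P0 dotE -!expr2 !addr_ge0 ?sqr_ge0.
pose r := Num.sqrt (dot (z 0).2 (z 0).2).
have r0 : 0 < r by rewrite sqrtr_gt0.
have rE : dot (z 0).2 (z 0).2 = r ^+ 2 by rewrite sqr_sqrtr // ltW.
have [y0O _ _] := Dy.
have y0q : body y0.1 0 = (z 0).1 by rewrite z0.
pose K := y0.1 *m frame r (z 0).1 (z 0).2.
have FO : orthogonal (frame r (z 0).1 (z 0).2).
  by apply: orthogonal_frame => //; case: (z 0) (zT 0).
have KO : O2 K.
  split; first exact: orthogonalM.
  by rewrite /K -mulmxA frame_basis -y0q bodyT // mulmxA orthogonal_mulmxT // mul1mx.
have P t : dot (z t).2 (z t).2 = r ^+ 2.
  by rewrite -rE (sol_normp J1_gt0 J2_gt0 zsol t 0).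
exists (fun t => lift J1 J2 K r (z t)).
  split; first exact: D_solution_lift.
  by move=> t; have [_ ->] := lift_proj J1_gt0 J2_gt0 (zT t) r0 (P t) KO.
rewrite [RHS]surjective_pairing /lift; congr (_, _).
  by rewrite /K -mulmxA orthogonal_mulmxT // mulmx1.
have [_] : TS (proj J y0) /\
    y0.2 = wedge (proj J y0).1 (vel J1 J2 (proj J y0).1 (proj J y0).2).
  by case: y0 Dy {z0 y0O y0q K KO FO} => g Om /(D_TS J1_gt0 J2_gt0).
by rewrite -z0.
Qed.

Variables (q1 p1 P : R).
Hypothesis gam0 : has_coords (gam 0) (q1, p1, P).

Lemma reconstruction_coords x : TS_reconstruction J gam x ->
  [/\ TS (x 0), gam 0 = O2_orbit (x 0), (x 0).1 0 0 = q1,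
      (x 0).2 0 0 = p1 & dot (x 0).2 (x 0).2 = P].
Proof.
move=> [xsol xE]; have [z [zT zE zc]] := gam0.
have /esym/esym/orbit_eq[h hO x0] : O2_orbit (x 0) = O2_orbit z by rewrite xE.
have := coords_act z hO; rewrite -x0 zc => -[-> -> ->].
by split=> //; case: (xsol 0).
Qed.

End Reconstructions.

Theorem theorem4p4 (R : realType) (J1 J2 : R)
    (hJ1 : 0 < J1) (hJ2 : 0 < J2) (hJ12 : J1 != J2)
    (gam : R -> set ('cV[R]_3 * 'cV[R]_3))
    (hgam : reduced_solution (mass J1 J2) gam)
    (q1 p1 P : R) (hcoords : has_coords (gam 0) (q1, p1, P)) :
  let J := mass J1 J2 in
  let A := S3 (gam 0) /\ (q1, p1) <> (0, 0) in
  let B := S3 (gam 0) /\ (q1, p1) = (0, 0) in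
  let C := S2 (gam 0) /\ 0 < P in
  reconstructible J gam /\
  [/\ A -> reconstructs_to J gam (quasi_periodic (TS_solution J))
                                 (quasi_periodic (D_solution J)),
      B -> reconstructs_to J gam (TS_steady_rotation J equatorial)
                                 (D_steady_rotation J equatorial),
      C -> reconstructs_to J gam (TS_steady_rotation J axial)
                                 (D_steady_rotation J axial)
    & ~ A -> ~ B -> ~ C ->
      reconstructs_to J gam (@equilibrium R _) (@equilibrium R _)].
Proof.
move=> J A B C; split; first exact: reconstructible_gam.
have start x : TS_reconstruction J gam x ->
    [/\ TS_solution J x, TS ((x 0).1, (x 0).2),
        S3 (gam 0) <-> cross (x 0).1 (x 0).2 0 0 != 0,
        (x 0).1 0 0 = q1 /\ (x 0).2 0 0 = p1 & dot (x 0).2 (x 0).2 = P].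
  move=> xrec; have [xT xE ? ? ?] := reconstruction_coords hcoords xrec.
  have [xsol _] := xrec; have xT' : TS ((x 0).1, (x 0).2) by case: (x 0) xT.
  by split=> //; rewrite xE; exact: S3P.
have L x : TS_reconstruction J gam x -> S3 (gam 0) -> cross (x 0).1 (x 0).2 0 0 != 0.
  by move=> /start[_ _ [S3L _] _ _]; exact: S3L.
split.
- move=> [/L L0 qp]; split=> [x xrec|y yrec].
    have [xsol _ _ [q0 p0] _] := start _ xrec.
    have qp0 : ((x 0).1 0 0, (x 0).2 0 0) <> (0, 0) by rewrite q0 p0.
    have [phi [w [? ? ? ? _]]] := invariant_torus hJ1 hJ2 xsol (L0 _ xrec) qp0.
    by exists phi, w.
  have xrec := D_TS_reconstruction hJ1 hJ2 yrec.
  have [_ _ _ [q0 p0] _] := start _ xrec; have [ysol _] := yrec.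
  by apply: (D_quasi_periodic hJ1 hJ2 ysol (L0 _ xrec)); rewrite q0 p0.
- move=> [s3 [q10 p10]]; split=> [x xrec|y yrec].
    have [xsol xT _ [q0 p0] _] := start _ xrec; have L0 := L _ xrec s3.
    rewrite q10 in q0; rewrite p10 in p0; have P0 := oriented_normp_gt0 xT L0.
    by apply: TS_steady => //; [right|exact: equatorial_qp].
  have xrec := D_TS_reconstruction hJ1 hJ2 yrec; have [ysol _] := yrec.
  have [xsol xT _ [q0 p0] _] := start _ xrec; have L0 := L _ xrec s3.
  rewrite q10 in q0; rewrite p10 in p0; have P0 := oriented_normp_gt0 xT L0.
  by apply: D_steady => //; [right|exact: equatorial_qp].
- move=> [s2 P0].
  have flat x : TS_reconstruction J gam x -> cross (x 0).1 (x 0).2 0 0 = 0.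
    move=> xrec; have [xT xE _ _ _] := reconstruction_coords hcoords xrec.
    by apply: S2_cross => //; rewrite -xE.
  split=> [x xrec|y yrec].
    have [xsol xT _ _ xP] := start _ xrec; have L0 := flat _ xrec.
    by apply: TS_steady; rewrite ?xP //; [left|apply: axial_qp; rewrite ?xP].
  have xrec := D_TS_reconstruction hJ1 hJ2 yrec; have [ysol _] := yrec.
  have [xsol xT _ _ xP] := start _ xrec; have L0 := flat _ xrec.
  by apply: D_steady; rewrite ?xP //; [left|apply: axial_qp; rewrite ?xP].
move=> nA nB nC.
have rest x : TS_reconstruction J gam x -> dot (x 0).2 (x 0).2 = 0.
  move=> xrec; have [xT xE _ _ xP] := reconstruction_coords hcoords xrec.
  have [_ _ s3P _ _] := start _ xrec.
  have L0 : cross (x 0).1 (x 0).2 0 0 = 0.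
    apply/eqP/negPn/negP => /s3P s3.
    by have [qp|/eqP qp] := eqVneq (q1, p1) (0, 0); [apply: nB|apply: nA].
  apply/eqP/negPn/negP => P0; apply: nC; rewrite /C xE -xP.
  have {}P0 : 0 < dot (x 0).2 (x 0).2.
    by rewrite lt_neqAle eq_sym P0 dotE -!expr2 !addr_ge0 ?sqr_ge0.
  by split=> //; exact: cross_S2.
split=> [x xrec|y yrec].
  by have [xsol _ _ _ _] := start _ xrec; apply: TS_equilibrium xsol (rest _ xrec).
have xrec := D_TS_reconstruction hJ1 hJ2 yrec; have [ysol _] := yrec.
exact: D_equilibrium ysol (rest _ xrec).
Qed.
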